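(* Assume $\#$QSETH holds. Then for each constant $\delta>0$ there is no bounded-error quantum algorithm that solves the strong simulation problem for quantum circuits on $n$ qubits up to a precision of $n+1$ bits in $\mathcal{O}(2^{n(1-\delta)})$ time.
   Context: Strong simulation problem with $p$-bit precision ($p\in\mathbb{N}$): given a quantum circuit $C$ on $n$ qubits and $x\in\{0,1\}^n$, write $|\langle x|C|0^n\rangle|=C_0.C_1C_2\ldots$ in binary and output $C_0.C_1\ldots C_{p-1}$. A bounded-error quantum algorithm outputs a correct answer with probability at least $2/3$ on every input. $\#$QSETH is the hypothesis: for each constant $\delta>0$ there exists $c>0$ such that there is no bounded-error quantum algorithm that, given a CNF formula on $n$ variables (even restricted to formulas with $m\le cn^2$ clauses), outputs its number of satisfying assignments in $\mathcal{O}(2^{n(1-\delta)})$ time. *)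

(* Defs.v *)
From HB Require Import structures.
From mathcomp Require Import all_boot all_order all_algebra.
From mathcomp Require Import complex.
From mathcomp Require Import all_classical all_reals all_analysis.
Set Implicit Arguments.
Unset Strict Implicit.
Unset Printing Implicit Defensive.
Import Order.TTheory GRing.Theory Num.Theory.
Local Open Scope classical_set_scope.
Local Open Scope ring_scope.

(** * CNF formulas *)

(* The literal (i, b) is satisfied when variable i has value b. *)
Definition literal (n : nat) : finType := ('I_n * bool)%type.
Definition clause (n : nat) := {set literal n}.
Definition cnf (n : nat) := seq (clause n).

Definition satisfies n (phi : cnf n) (a : {ffun 'I_n -> bool}) : bool :=
  all (fun A : clause n => [exists l in A, a l.1 == l.2]) phi.

Definition count_sat n (phi : cnf n) : nat :=
  #|[set a : {ffun 'I_n -> bool} | satisfies phi a]%SET|.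

(** * Quantum gates and circuits *)

(* Clifford+T, with the derived gates X and Toffoli for convenience; the
   qubits are named by elements of Q. *)
Inductive gate (Q : Type) : Type :=
| GX (q : Q)
| GH (q : Q)
| GT (q : Q)
| GCX (c t : Q)
| GCCX (c1 c2 t : Q).

Definition gate_map (Q Q' : Type) (f : Q -> Q') (g : gate Q) : gate Q' :=
  match g with
  | GX q => GX (f q)
  | GH q => GH (f q)
  | GT q => GT (f q)
  | GCX c t => GCX (f c) (f t)
  | GCCX c1 c2 t => GCCX (f c1) (f c2) (f t)
  end.

Definition gate_qubits (Q : Type) (g : gate Q) : seq Q :=
  match g with
  | GX q | GH q | GT q => [:: q]
  | GCX c t => [:: c; t]
  | GCCX c1 c2 t => [:: c1; c2; t]
  end.

Definition gate_wf (Q : eqType) (g : gate Q) : bool := uniq (gate_qubits g).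

Definition upd (Q : eqType) (T : Type) (b : Q -> T) (q : Q) (v : T) : Q -> T :=
  fun q' => if q' == q then v else b q'.

Definition flip (Q : eqType) (b : Q -> bool) (q : Q) : Q -> bool :=
  upd b q (~~ b q).

(* A basis state is a bit assignment Q -> bool; a vector is given by its
   amplitudes.  Q = nat is used for an unbounded register, whose vectors
   always have finite support when the initial one has. *)
Definition qvec (R : realType) (Q : eqType) := (Q -> bool) -> complex R.

Definition ket0 (R : realType) (Q : eqType) : qvec R Q :=
  fun b => (b == (fun _ => false))%:R.

(* 1 / sqrt 2 and exp(i pi / 4) *)
Definition rsqrt2 (R : realType) : R := (Num.sqrt 2)^-1.
Definition omega8 (R : realType) : complex R := Complex (rsqrt2 R) (rsqrt2 R).

(* The permutation gates are involutions, so the amplitude of the image at b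
   is the original amplitude at the image of b. *)
Definition apply_gate (R : realType) (Q : eqType) (g : gate Q)
    (psi : qvec R Q) : qvec R Q :=
  match g with
  | GX q => fun b => psi (flip b q)
  | GH q => fun b => Complex (rsqrt2 R) 0 *
      (psi (upd b q false) + (-1) ^+ b q * psi (upd b q true))
  | GT q => fun b => (if b q then omega8 R else 1) * psi b
  | GCX c t => fun b => psi (if b c then flip b t else b)
  | GCCX c1 c2 t => fun b => psi (if b c1 && b c2 then flip b t else b)
  end.

(* Gates are applied from left to right.  A circuit on n qubits is a value
   C : circuit n such that all (@gate_wf _) C. *)
Definition circuit (n : nat) := seq (gate 'I_n).

Definition run_circuit (R : realType) n (C : circuit n) (psi : qvec R 'I_n) :
    qvec R 'I_n :=
  foldl (fun psi g => apply_gate g psi) psi C.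

(* | <x| C |0^n> | *)
Definition amplitude_abs (R : realType) n (C : circuit n) (x : n.-tuple bool) :
    R :=
  Normc.normc (run_circuit C (@ket0 R 'I_n) (tnth x)).

(** * Quantum algorithms *)

(* An algorithm is a single classical program driving a quantum register.
   The classical memory consists of arrays of natural numbers, the register
   of infinitely many qubits, and both are addressed by natural numbers.
   Every instruction costs one unit of time.  Since the only arithmetic is
   successor and predecessor, in t steps numbers grow by at most O(t), so that
   the unit cost is fair (as in successor random-access machines): addition
   or multiplication at unit cost would make the model too powerful for
   fine-grained bounds. *)

Inductive expr : Type :=
| Cst (k : nat)
| Get (a : nat) (e : expr)
| Succ (e : expr)
| Pred (e : expr)
| Leq (e1 e2 : expr).

Inductive cmd : Type :=
| Skip
| Put (a : nat) (e v : expr)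
| Seq (c1 c2 : cmd)
| If (e : expr) (c1 c2 : cmd)
| While (e : expr) (c : cmd)
| Gate (g : gate expr)
| Meas (q : expr) (a : nat) (e : expr).

Definition memory := nat -> nat -> nat.

Definition write (m : memory) (a i v : nat) : memory := upd m a (upd (m a) i v).

Fixpoint eval (m : memory) (e : expr) : nat :=
  match e with
  | Cst k => k
  | Get a e => m a (eval m e)
  | Succ e => (eval m e).+1
  | Pred e => (eval m e).-1
  | Leq e1 e2 => (eval m e1 <= eval m e2)%N
  end.

(* A branch of the computation: the commands still to be executed, the
   classical memory, and the unnormalised quantum state, whose squared norm is
   the probability of the branch. *)
Record config (R : realType) := Config {
  todo : seq cmd;
  cmem : memory;
  qst : qvec R nat
}.

Definition project (R : realType) (Q : eqType) (q : Q) (v : bool)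
    (psi : qvec R Q) : qvec R Q :=
  fun b => (b q == v)%:R * psi b.

(* A gate whose addresses are not pairwise distinct has no effect. *)
Definition step (R : realType) (s : config R) : seq (config R) :=
  let: Config k m psi := s in
  match k with
  | [::] => [:: s]
  | i :: k =>
    match i with
    | Skip => [:: Config k m psi]
    | Put a e v => [:: Config k (write m a (eval m e) (eval m v)) psi]
    | Seq c1 c2 => [:: Config [:: c1, c2 & k] m psi]
    | If e c1 c2 =>
        [:: Config ((if eval m e != 0%N then c1 else c2) :: k) m psi]
    | While e c =>
        [:: Config (if eval m e != 0%N then [:: c, While e c & k] else k) m psi]
    | Gate g =>
        let g' := gate_map (eval m) g in
        [:: Config k m (if gate_wf g' then apply_gate g' psi else psi)]
    | Meas q a e =>
        [seq Config k (write m a (eval m e) (nat_of_bool v))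
                      (project (eval m q) v psi) | v <- [:: false; true]]
    end
  end.

Definition steps (R : realType) (t : nat) (s : config R) : seq (config R) :=
  iter t (fun ss => flatten [seq step s' | s' <- ss]) [:: s].

Definition sqnorm (R : realType) (psi : qvec R nat) : R :=
  \sum_(b \in [set: nat -> bool]) Normc.normc (psi b) ^+ 2.

Definition prob (R : realType) (ss : seq (config R)) (p : config R -> bool) :
    R :=
  \sum_(s <- ss | p s) sqnorm (qst s).

(* The input word is in array 0, all other cells are 0 and all qubits |0>. *)
Definition init (R : realType) (P : cmd) (w : seq nat) : config R :=
  Config [:: P] (fun a i => if a == 0%N then nth 0%N w i else 0%N)
         (@ket0 R nat).

Definition halted (R : realType) (s : config R) : bool := nilp (todo s).

(* The output is read at the beginning of array 1. *)
Definition outputs (R : realType) (ans : seq nat) (s : config R) : bool :=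
  mkseq (cmem s 1%N) (size ans) == ans.

(* On input w, P always halts within time T, and its output is ans with
   probability at least 2/3. *)
Definition computes_within (R : realType) (P : cmd) (w ans : seq nat) (T : R) :
    Prop :=
  exists t : nat,
    [/\ t%:R <= T,
        prob (steps t (init R P w)) (@halted R) = 1
      & 2 / 3 <= prob (steps t (init R P w))
                      (fun s => halted s && outputs ans s)].

(** * The two problems *)

(* Clauses are listed as in the DIMACS format: non-zero codes of literals,
   terminated by 0. *)
Definition encode_clause n (A : clause n) : seq nat :=
  rcons [seq (l.1.*2 + l.2).+1 | l : literal n <- enum A] 0%N.

Definition encode_cnf n (phi : cnf n) : seq nat :=
  [:: n, size phi & flatten [seq encode_clause A | A <- phi]].

(* The number k <= 2 ^ n on n + 1 bits, most significant bit first. *)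
Definition binary (n k : nat) : seq nat :=
  mkseq (fun i => (k %/ 2 ^ (n - i)) %% 2)%N n.+1.

(* Four numbers per gate: opcode and addresses, padded with 0. *)
Definition encode_gate n (g : gate 'I_n) : seq nat :=
  match g with
  | GX q => [:: 0; q : nat; 0; 0]
  | GH q => [:: 1; q : nat; 0; 0]
  | GT q => [:: 2; q : nat; 0; 0]
  | GCX c t => [:: 3; c : nat; t : nat; 0]
  | GCCX c1 c2 t => [:: 4; c1 : nat; c2 : nat; t : nat]
  end%N.

Definition encode_strong n (C : circuit n) (x : n.-tuple bool) : seq nat :=
  n :: [seq nat_of_bool b | b <- x]
    ++ size C :: flatten [seq encode_gate g | g <- C].

(* The first p digits r_0, ..., r_(p-1) of r = r_0.r_1r_2... for 0 <= r < 2
   (the expansion of a dyadic r being the terminating one). *)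
Definition binary_digits (R : realType) (p : nat) (r : R) : seq nat :=
  mkseq (fun i => Num.truncn (2 ^+ i * r) %% 2)%N p.

(* P counts the satisfying assignments of the CNF formulas with n variables
   and at most c n^2 clauses in time O(2^(n (1 - delta))). *)
Definition counts_sat (R : realType) (delta c : R) (P : cmd) : Prop :=
  exists K : R, forall (n : nat) (phi : cnf n),
    (size phi)%:R <= c * n%:R ^+ 2 ->
    computes_within P (encode_cnf phi) (binary n (count_sat phi))
      (K * 2 `^ (n%:R * (1 - delta))).

Definition sharp_QSETH (R : realType) : Prop :=
  forall delta : R, 0 < delta ->
    exists2 c : R, 0 < c & ~ exists P : cmd, counts_sat delta c P.

(* P solves the strong simulation problem for circuits on n qubits up to
   precision p n in time O(2^(n (1 - delta))).  A time bound in terms of n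
   alone presupposes that the number of gates is polynomial in n: the implied
   constant K may depend on the polynomial.  Every circuit is covered by some
   polynomial, so P must be correct on all circuits. *)
Definition strongly_simulates (R : realType) (p : nat -> nat) (delta : R)
    (P : cmd) : Prop :=
  forall a d : nat, exists K : R,
    forall (n : nat) (C : circuit n) (x : n.-tuple bool),
      all (@gate_wf _) C -> (size C <= a * n.+1 ^ d)%N ->
      computes_within P (encode_strong C x)
        (binary_digits (p n) (amplitude_abs R C x))
        (K * 2 `^ (n%:R * (1 - delta))).

(* Main.v *)
(* A CNF formula phi on n variables becomes a circuit on n + O(log |phi|)
   qubits: Hadamard gates on the variables, a reversible computation, and the
   same Hadamard gates again.  The computation adds the number of falsified
   clauses to the upper half of a counter of 2 L bits whose other half is
   returned to 0, so it fixes |x, 0> exactly when x satisfies phi, and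
   otherwise it maps |x, 0> outside the span of the states |y, 0>.  Hence
   <0|C|0> = #SAT / 2^n, whose first n + 1 binary digits are those of #SAT.

   To test one clause, start from lower half 0, add the number t of true
   literals, complement to 2^L - 1 - t, add 1 to the whole counter (this
   carries into the upper half iff t = 0, and leaves -t mod 2^L below), and add
   t once more.  Only controlled increments are needed, each with a chain of
   clean carry qubits.

   The circuit is written in time polynomial in n, and the O(log n) additional
   qubits multiply the running time 2^(N (1 - delta)) of the simulation by a
   polynomial only, which 2^(n delta / 2) absorbs. *)

From HB Require Import structures.
From mathcomp Require Import all_boot all_order all_algebra.
From mathcomp Require Import complex zify ring lra.
From mathcomp Require Import all_classical all_reals all_analysis.
Require Import Defs.
Set Implicit Arguments.
Unset Strict Implicit.
Unset Printing Implicit Defensive.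
Import Order.TTheory GRing.Theory Num.Theory.

(** * Classical gates and the reversible counter *)

Definition classical_gate (Q : Type) (g : gate Q) : bool :=
  match g with GH _ | GT _ => false | _ => true end.

(** The value on H and T is a placeholder; [run_classical] assumes that they are absent. *)
Definition act (Q : eqType) (g : gate Q) (b : Q -> bool) : Q -> bool :=
  match g with
  | GX q => flip b q
  | GCX c t => if b c then flip b t else b
  | GCCX c1 c2 t => if b c1 && b c2 then flip b t else b
  | _ => b
  end.

Definition acts (Q : eqType) (C : seq (gate Q)) (b : Q -> bool) : Q -> bool :=
  foldl (fun b g => act g b) b C.

Lemma acts_cat (Q : eqType) (C D : seq (gate Q)) b :
  acts (C ++ D) b = acts D (acts C b).
Proof. exact: foldl_cat. Qed.

Lemma flipE (Q : eqType) (b : Q -> bool) q q' :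
  flip b q q' = b q' (+) (q' == q).
Proof. by rewrite /flip /upd; case: eqP => [->|_]; case: (b _). Qed.

Lemma flipK (Q : eqType) (q : Q) : involutive (fun b : Q -> bool => flip b q).
Proof. by move=> b; apply/funext => q'; rewrite !flipE -addbA addbb addbF. Qed.

Lemma actK (Q : eqType) (g : gate Q) :
  gate_wf g -> involutive (act g).
Proof.
case: g => [q|q|q|c t|c d t] //= wf b; first exact: flipK.
  move: wf; rewrite /gate_wf /= inE andbT => /negbTE wf.
  by case bc: (b c); rewrite ?flipE ?wf bc ?flipK.
move: wf; rewrite /gate_wf /= !inE negb_or => /and3P[/andP[_ /negbTE wf] /negbTE wf' _].
by case bc: (b c && b d); rewrite ?flipE ?wf ?wf' ?addbF bc ?flipK.
Qed.

Lemma acts_revK (Q : eqType) (C : seq (gate Q)) :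
  all (@gate_wf _) C -> cancel (acts (rev C)) (acts C).
Proof.
elim/last_ind: C => [//|C g IH]; rewrite all_rcons => /andP[wf wfC] b.
by rewrite rev_rcons -cats1 acts_cat /= (IH wfC) actK.
Qed.

Lemma acts_Krev (Q : eqType) (C : seq (gate Q)) :
  all (@gate_wf _) C -> cancel (acts C) (acts (rev C)).
Proof. by move=> wf; rewrite -{1}(revK C); apply: acts_revK; rewrite all_rev. Qed.

(** A permutation gate pulls amplitudes back along its involution, so reading off one amplitude
    applies the gates in reverse order. *)
Lemma run_classical (R : realType) n (C : circuit n) (psi : qvec R 'I_n) b :
  all (@classical_gate _) C ->
  run_circuit C psi b = psi (acts (rev C) b).
Proof.
elim: C psi => [//|g C IH] psi /= /andP[cg cC].
rewrite rev_cons -cats1 acts_cat /= [LHS](IH _ cC).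
by case: g cg.
Qed.

Lemma act_map n (o : nat -> 'I_n) (g : gate nat) (b : nat -> bool) :
  all (fun q => nat_of_ord (o q) == q) (gate_qubits g) ->
  act (gate_map o g) (fun q : 'I_n => b q) = (fun q : 'I_n => act g b q).
Proof.
have flipo q : nat_of_ord (o q) == q ->
    flip (fun q : 'I_n => b q) (o q) = (fun q' : 'I_n => flip b q q').
  by move=> /eqP oq; apply/funext => q'; rewrite !flipE -val_eqE /= oq.
case: g => [q|q|q|c t|c d t] //=.
- by rewrite andbT => /flipo.
- by move=> /and3P[/eqP-> /flipo-> _]; case: ifP.
- by move=> /and4P[/eqP-> /eqP-> /flipo-> _]; case: ifP.
Qed.

(** Circuits are built on addresses in [nat], where arithmetic is easy; this transports their action
    to ['I_n] when [o] keeps every address in use. *)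
Lemma acts_map n (o : nat -> 'I_n) (C : seq (gate nat)) (b : nat -> bool) :
  all (fun g => all (fun q => nat_of_ord (o q) == q) (gate_qubits g)) C ->
  acts (map (gate_map o) C) (fun q : 'I_n => b q) = (fun q : 'I_n => acts C b q).
Proof.
elim: C b => [//|g C IH] b /= /andP[og oC].
by rewrite act_map //; exact: IH.
Qed.

(** The variables come first, then carry qubits and register bits in alternation. This makes each
    carry step act on three consecutive qubits, whose addresses are found with successor and
    predecessor alone. *)
Definition layout (n : nat) (x a r : nat -> bool) : nat -> bool :=
  fun q => if q < n then x q else
    if odd (q - n) then r (q - n)./2 else a (q - n)./2.

Definition carry_qubit (n j : nat) : nat := n + j.*2.
Definition reg_qubit (n j : nat) : nat := (n + j.*2).+1.

Lemma layout_carry n x a r j : layout n x a r (carry_qubit n j) = a j.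
Proof. by rewrite /layout /carry_qubit ltnNge leq_addr /= addKn odd_double doubleK. Qed.

Lemma layout_reg n x a r j : layout n x a r (reg_qubit n j) = r j.
Proof.
rewrite /layout /reg_qubit ltnNge -addnS leq_addr /= addKn /= odd_double /=.
by rewrite uphalf_double.
Qed.

Lemma layout_var n x a r q : q < n -> layout n x a r q = x q.
Proof. by rewrite /layout => ->. Qed.

Lemma flip_carry n x a r j :
  flip (layout n x a r) (carry_qubit n j) = layout n x (flip a j) r.
Proof.
apply/funext => q; rewrite flipE /layout /carry_qubit.
case: ltnP => [lt_qn|le_nq].
  by rewrite (_ : q == _ = false) ?addbF //; apply/eqP; lia.
case: ifP => odq.
  by rewrite (_ : q == _ = false) ?addbF //; apply/eqP; lia.
rewrite flipE; congr (_ (+) _); apply/eqP/eqP; lia.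
Qed.

Lemma flip_reg n x a r j :
  flip (layout n x a r) (reg_qubit n j) = layout n x a (flip r j).
Proof.
apply/funext => q; rewrite flipE /layout /reg_qubit.
case: ltnP => [lt_qn|le_nq].
  by rewrite (_ : q == _ = false) ?addbF //; apply/eqP; lia.
case: ifP => odq; last first.
  by rewrite (_ : q == _ = false) ?addbF //; apply/eqP; lia.
rewrite flipE; congr (_ (+) _); apply/eqP/eqP; lia.
Qed.

(** * Controlled increment with a chain of carries *)

Fixpoint inc_up (n j k : nat) : seq (gate nat) :=
  if k is k'.+1
  then GCCX (carry_qubit n j) (reg_qubit n j) (carry_qubit n j.+1) :: inc_up n j.+1 k'
  else [::].

(** After [inc_up] has written the carries into clean qubits, each bit receives its carry before
    that carry is erased; the erasing Toffoli gate reads bit [k'] while it still has its old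
    value. *)
Fixpoint inc_down (n k : nat) : seq (gate nat) :=
  if k is k'.+1
  then [:: GCX (carry_qubit n k) (reg_qubit n k),
           GCCX (carry_qubit n k') (reg_qubit n k') (carry_qubit n k)
         & inc_down n k']
  else [::].

(* Adds the bit held by carry 0 to the lowest [e] bits of the register. *)
Definition inc (n e : nat) : seq (gate nat) :=
  inc_up n 0 e.-1 ++ rcons (inc_down n e.-1) (GCX (carry_qubit n 0) (reg_qubit n 0)).

Definition carry (t : bool) (r : nat -> bool) (j : nat) : bool :=
  t && all r (iota 0 j).

Lemma carryS t r j : carry t r j.+1 = carry t r j && r j.
Proof. by rewrite /carry -addn1 iotaD all_cat /= andbT andbA. Qed.

(** Contents of the carry qubits once the carries up to position [k] have been written. *)
Definition carries (t : bool) (r : nat -> bool) (k : nat) : nat -> bool :=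
  fun j => (j <= k) && carry t r j.

Definition incr (e : nat) (t : bool) (r : nat -> bool) : nat -> bool :=
  fun j => if j < e then r j (+) carry t r j else r j.

Lemma carries_flip t r k :
  (if carry t r k.+1 then flip (carries t r k) k.+1 else carries t r k)
  = carries t r k.+1.
Proof.
apply/funext => j.
transitivity (carries t r k j (+) (carry t r k.+1 && (j == k.+1))).
  by case: ifP => _; rewrite ?flipE //= addbF.
rewrite /carries (leq_eqVlt j k.+1) ltnS; case: (eqVneq j k.+1) => [->|_].
  by rewrite ltnn andbT.
by rewrite andbF addbF.
Qed.

Lemma act_carry n x t r r' k : r' k = r k ->
  act (GCCX (carry_qubit n k) (reg_qubit n k) (carry_qubit n k.+1))
    (layout n x (carries t r k) r')
  = layout n x (carries t r k.+1) r'.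
Proof.
move=> rk; rewrite /= layout_carry layout_reg flip_carry rk /carries leqnn /=.
by rewrite -carryS -[in RHS]/(carries t r k.+1) -carries_flip; case: ifP.
Qed.

Lemma act_uncarry n x t r r' k : r' k = r k ->
  act (GCCX (carry_qubit n k) (reg_qubit n k) (carry_qubit n k.+1))
    (layout n x (carries t r k.+1) r')
  = layout n x (carries t r k) r'.
Proof.
move=> rk; rewrite -(act_carry n x t rk) actK // /gate_wf /= !inE /carry_qubit /reg_qubit.
by rewrite negb_or !andbT -andbA; apply/and3P; split; apply/eqP; lia.
Qed.

Lemma acts_inc_up n x t r j k :
  acts (inc_up n j k) (layout n x (carries t r j) r)
  = layout n x (carries t r (j + k)) r.
Proof.
elim: k j => [|k IH] j; first by rewrite addn0.
by rewrite [inc_up _ _ _]/= -cat1s acts_cat [acts [:: _] _]act_carry // IH addSnnS.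
Qed.

(** On the way down the bits above [k] have already changed, so the current register [r'] is kept
    apart from the [r] that determines the carries; they agree only up to [k]. *)
Lemma acts_inc_down n x t r r' k : (forall j, j <= k -> r' j = r j) ->
  acts (inc_down n k) (layout n x (carries t r k) r')
  = layout n x (carries t r 0)
      (fun j => if 0 < j <= k then r' j (+) carry t r j else r' j).
Proof.
elim: k r' => [|k IH] r' eqr.
  by congr layout; apply/funext => j; rewrite leqn0; case: j.
rewrite [inc_down _ _]/= -[_ :: _]/([:: _] ++ ([:: _] ++ _)) !acts_cat.
have -> : acts [:: GCX (carry_qubit n k.+1) (reg_qubit n k.+1)]
    (layout n x (carries t r k.+1) r') =
    layout n x (carries t r k.+1)
      (fun j => r' j (+) ((j == k.+1) && carry t r j)).
  rewrite /= layout_carry flip_reg /carries leqnn /=.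
  case: ifPn => cr; congr layout; apply/funext => j; rewrite ?flipE.
    by case: eqP => // ->; rewrite cr.
  by case: eqP => [->|_]; rewrite ?(negbTE cr) addbF.
rewrite [acts [:: _] _]act_uncarry; last first.
  by rewrite eqr // (_ : k == _ = false) ?addbF //; apply/eqP; lia.
rewrite IH; last first.
  move=> j jk; rewrite eqr ?(leq_trans jk) //.
  by rewrite (_ : j == _ = false) ?addbF //; apply/eqP; lia.
congr layout; apply/funext => j.
case: (eqVneq j k.+1) => [->|neq]; first by rewrite ltnn /= leqnn.
rewrite addbF (_ : (0 < j <= k.+1) = (0 < j <= k)) //; lia.
Qed.

Definition unit_carry (t : bool) : nat -> bool := fun j => (j == 0) && t.

Lemma carries0 t r : carries t r 0 = unit_carry t.
Proof.
by apply/funext => -[|j] //; rewrite /carries /carry /unit_carry /= andbT.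
Qed.

Lemma acts_inc n x t r e : 0 < e ->
  acts (inc n e) (layout n x (unit_carry t) r)
  = layout n x (unit_carry t) (incr e t r).
Proof.
case: e => // e _; rewrite /inc -cats1 !acts_cat -(carries0 t r) /= acts_inc_up.
rewrite add0n acts_inc_down // layout_carry flip_reg {1}/carries /=.
transitivity (layout n x (carries t r 0) (fun j => r j (+) ((j <= e) && carry t r j))).
  case: ifPn => cr; congr layout; apply/funext => -[|j]; rewrite ?flipE /= ?addbF.
  - by rewrite cr.
  - by case: ifP => _; rewrite ?addbF.
  - by rewrite (negbTE cr) addbF.
  - by case: ifP => _; rewrite ?addbF.
by congr layout; apply/funext => j; rewrite /incr ltnS; case: leqP; rewrite ?addbF.
Qed.

(** * Values of the two halves of the counter *)

Definition val_bits (k : nat) (r : nat -> bool) : nat := \sum_(i < k) r i * 2 ^ i.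

Lemma val_bitsS k r : val_bits k.+1 r = val_bits k r + r k * 2 ^ k.
Proof. exact: big_ord_recr. Qed.

Lemma val_bitsD k l r :
  val_bits (k + l) r = val_bits k r + 2 ^ k * val_bits l (fun i => r (k + i)).
Proof.
elim: l => [|l IH]; first by rewrite /val_bits big_ord0 muln0 !addn0.
by rewrite addnS !val_bitsS IH mulnDr addnA mulnCA expnD.
Qed.

Lemma val_bits_lt k r : val_bits k r < 2 ^ k.
Proof.
elim: k => [|k IH]; first by rewrite /val_bits big_ord0.
by rewrite val_bitsS expnS; case: (r k); lia.
Qed.

Lemma val_bits_eq0 k r i : val_bits k r = 0 -> i < k -> r i = false.
Proof.
move=> /eqP; rewrite sum_nat_eq0 => /forallP h ik.
by move: (h (Ordinal ik)) => /=; rewrite muln_eq0 expn_eq0 orbF; case: (r i).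
Qed.

Lemma eq_val_bits k r r' : (forall i, i < k -> r i = r' i) ->
  val_bits k r = val_bits k r'.
Proof. by move=> e; apply: eq_bigr => i _; rewrite e. Qed.

Lemma val_bits0 k : val_bits k (fun=> false) = 0.
Proof. by rewrite /val_bits big1. Qed.

(** Ripple-carry invariant: the low [k] bits and the carry out of them account for the exact sum.
    Taking [k < e] isolates the lower half of a longer counter. *)
Lemma val_bits_incr k e t r : k <= e ->
  val_bits k (incr e t r) + carry t r k * 2 ^ k = val_bits k r + t.
Proof.
elim: k => [|k IH] ke.
  by rewrite /val_bits !big_ord0 /carry /= andbT muln1.
rewrite !val_bitsS carryS {2}/incr ke expnS.
have := IH (ltnW ke).
by case: (carry t r k); case: (r k) => /=; lia.
Qed.

Lemma val_bits_not k r :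
  val_bits k (fun j => ~~ r j) = 2 ^ k - 1 - val_bits k r.
Proof.
elim: k => [|k IH]; first by rewrite /val_bits !big_ord0.
have := val_bits_lt k r.
by rewrite !val_bitsS IH expnS; case: (r k) => /=; lia.
Qed.

Definition holds (L : nat) (r : nat -> bool) (l h : nat) : Prop :=
  val_bits L r = l /\ val_bits L (fun i => r (L + i)) = h.

Lemma holds_incr_low L t r l h : holds L r l h ->
  holds L (incr L t r) ((l + t) %% 2 ^ L) h.
Proof.
case=> hl hh; split; last first.
  by rewrite -hh; apply: eq_val_bits => i _; rewrite /incr ltnNge leq_addr.
have := val_bits_incr t r (leqnn L); rewrite hl => <-.
by rewrite addnC modnMDl modn_small // val_bits_lt.
Qed.

(** The carry leaves the lower half precisely when that half is all ones; the bound on [h] rules out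
    an overflow of the upper half. *)
Lemma holds_incr_full L r l h : holds L r l h -> h.+1 < 2 ^ L ->
  holds L (incr L.*2 true r) (l.+1 %% 2 ^ L) (h + (l.+1 == 2 ^ L)).
Proof.
case=> hl hh hlt.
have l_lt : l < 2 ^ L by rewrite -hl val_bits_lt.
have := val_bits_incr true r (leqnn L.*2).
rewrite -addnn val_bitsD (val_bitsD L L r) hl hh.
set l' := val_bits L _; set h' := val_bits L _.
have l'_lt : l' < 2 ^ L by exact: val_bits_lt.
have eq_low : l' = l.+1 %% 2 ^ L.
  have := @val_bits_incr L (L + L) true r (leq_addr _ _); rewrite hl -/l' addn1 => <-.
  by rewrite addnC modnMDl modn_small.
rewrite expnD => eq_full; rewrite /holds; split=> //.
have l1 : l.+1 %% 2 ^ L = if l.+1 == 2 ^ L then 0 else l.+1.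
  by case: eqP => [->|ne]; rewrite ?modnn // modn_small //; lia.
rewrite -/h'; move: eq_full; rewrite eq_low l1 => {l1}.
set c := carry _ _ _ => eq_full.
(* Here [c] is the carry out of the whole counter. After cancelling 2^L, a true [c] would contradict
   [h.+1 < 2 ^ L]. *)
have /eqP : 2 ^ L * (h' + c * 2 ^ L) = 2 ^ L * (h + (l.+1 == 2 ^ L)).
  rewrite !mulnDr mulnCA; move: eq_full.
  by case: eqP => [e|_]; rewrite /= ?muln1 ?muln0; [rewrite -{3}e|]; lia.
rewrite eqn_pmul2l ?expn_gt0 // => /eqP; have := leq_b1 (l.+1 == 2 ^ L).
by case: c {eq_full} => /=; lia.
Qed.

Lemma holds_not L r l h : holds L r l h ->
  holds L (fun j => r j (+) (j < L)) (2 ^ L - 1 - l) h.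
Proof.
case=> <- <-; split; last first.
  by apply: eq_val_bits => i _; rewrite ltnNge leq_addr addbF.
by rewrite -val_bits_not; apply: eq_val_bits => i ->; rewrite addbT.
Qed.

(** * Gates testing the clauses *)

Definition neg_gates (n : nat) (v : bool) : seq (gate nat) :=
  if v then [::] else [:: GX (carry_qubit n 0)].

(** Carry qubit 0 is the input bit of [inc]: the truth value of the literal is computed there, added
    to the register, and erased by the mirrored gates. *)
Definition lit_gates (n L : nat) (l : nat * bool) : seq (gate nat) :=
  [:: GCX l.1 (carry_qubit n 0)] ++ neg_gates n l.2 ++ inc n L ++
  neg_gates n l.2 ++ [:: GCX l.1 (carry_qubit n 0)].

Definition clause_lits (n L : nat) (A : seq (nat * bool)) : seq (gate nat) :=
  flatten (map (lit_gates n L) A).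

Fixpoint nots (n j k : nat) : seq (gate nat) :=
  if k is k'.+1 then GX (reg_qubit n j) :: nots n j.+1 k' else [::].

Definition clause_gates (n L : nat) (A : seq (nat * bool)) : seq (gate nat) :=
  clause_lits n L A ++ nots n 0 L ++ neg_gates n false ++ inc n L.*2 ++
  neg_gates n false ++ clause_lits n L A.

Definition cnf_gates (n L : nat) (phi : seq (seq (nat * bool))) :=
  flatten (map (clause_gates n L) phi).

Lemma flip_unit_carry t : flip (unit_carry t) 0 = unit_carry (~~ t).
Proof. by apply/funext => -[|j]; rewrite flipE /unit_carry //= addbT. Qed.

Lemma acts_lit n L x r l : 0 < L -> l.1 < n ->
  acts (lit_gates n L l) (layout n x (unit_carry false) r)
  = layout n x (unit_carry false) (incr L (x l.1 == l.2) r).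
Proof.
case: l => i b L0 ltin; rewrite /lit_gates.
have act1 t r' : acts [:: GCX i (carry_qubit n 0)] (layout n x (unit_carry t) r') =
    layout n x (unit_carry (t (+) x i)) r'.
  rewrite /= layout_var // flip_carry flip_unit_carry.
  by case: (x i); rewrite ?addbT ?addbF.
have neg t r' : acts (neg_gates n b)
    (layout n x (unit_carry t) r') = layout n x (unit_carry (t == b)) r'.
  rewrite /neg_gates; case: {ltin} b; rewrite ?eqb_id //=.
  by rewrite flip_carry flip_unit_carry; case: t.
move=> {ltin}; rewrite (acts_cat [:: _]) act1 (acts_cat (neg_gates n b)) neg.
rewrite (acts_cat (inc n L)) acts_inc // (acts_cat (neg_gates n b)) neg act1.
by case: (x i); case: (b).
Qed.

Definition true_lits (x : nat -> bool) (A : seq (nat * bool)) : nat :=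
  count (fun l => x l.1 == l.2) A.

Lemma acts_clause_lits n L x r A l h : 0 < L ->
  all (fun l => l.1 < n) A -> holds L r l h -> exists2 r',
  acts (clause_lits n L A) (layout n x (unit_carry false) r)
  = layout n x (unit_carry false) r' &
  holds L r' ((l + true_lits x A) %% 2 ^ L) h.
Proof.
move=> L0; elim: A r l => [|a A IH] r l wf hr.
  exists r => //; rewrite addn0 modn_small //.
  by case: hr => <- _; exact: val_bits_lt.
case/andP: wf => wfa wfA.
have /(IH _ _ wfA)[r' eqr' hr'] := holds_incr_low (x a.1 == a.2) hr.
exists r'.
  by rewrite -[clause_lits _ _ _]/(lit_gates n L a ++ _) acts_cat acts_lit.
by move: hr'; rewrite modnDml -addnA [true_lits _ _]/=.
Qed.

Lemma acts_nots n x a r j k :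
  acts (nots n j k) (layout n x a r)
  = layout n x a (fun i => r i (+) (j <= i < j + k)).
Proof.
elim: k j r => [|k IH] j r /=.
  congr layout; apply/funext => i; rewrite addn0.
  by rewrite (_ : (_ <= _ < _) = false) ?addbF //; lia.
rewrite flip_reg [LHS]IH; congr layout; apply/funext => i.
rewrite flipE -addbA; congr (_ (+) _); rewrite addSnnS.
by case: (eqVneq i j) => [->|ne]; lia.
Qed.

(** With t true literals the lower half passes through 0, t, 2^L - 1 - t, 2^L - t modulo 2^L, and 0
    again. Since t < 2^L, the middle increment carries exactly for t = 0. *)
Lemma acts_clause n L x r A h : 0 < L ->
  all (fun l => l.1 < n) A -> size A < 2 ^ L -> h.+1 < 2 ^ L ->
  holds L r 0 h -> exists2 r',
  acts (clause_gates n L A) (layout n x (unit_carry false) r)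
  = layout n x (unit_carry false) r' &
  holds L r' 0 (h + (true_lits x A == 0)).
Proof.
move=> L0 wf szA hlt hr.
have tA : true_lits x A < 2 ^ L by rewrite (leq_ltn_trans (count_size _ _)).
have [r1 eq1] := acts_clause_lits x L0 wf hr; rewrite add0n modn_small // => h1.
have h2 := holds_not h1.
have h3 := holds_incr_full h2 hlt.
have [r4 eq4 h4] := acts_clause_lits x L0 wf h3.
exists r4.
  have neg t r' : acts (neg_gates n false) (layout n x (unit_carry t) r') =
      layout n x (unit_carry (~~ t)) r' by rewrite /= flip_carry flip_unit_carry.
  rewrite /clause_gates acts_cat eq1 (acts_cat (nots n 0 L)) acts_nots.
  rewrite (acts_cat (neg_gates n false)) neg (acts_cat (inc n L.*2)).
  by rewrite acts_inc ?double_gt0 // (acts_cat (neg_gates n false)) neg eq4.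
move: h4; have -> : (2 ^ L - 1 - true_lits x A).+1 = 2 ^ L - true_lits x A by lia.
rewrite modnDml subnK ?(ltnW tA) // modnn.
by have -> : (2 ^ L - true_lits x A == 2 ^ L) = (true_lits x A == 0) by apply/eqP/eqP; lia.
Qed.

Lemma acts_cnf n L x phi : 0 < L ->
  all (all (fun l => l.1 < n)) phi -> all (fun A => size A < 2 ^ L) phi ->
  size phi < 2 ^ L -> exists2 r,
  acts (cnf_gates n L phi) (layout n x (unit_carry false) (fun=> false))
  = layout n x (unit_carry false) r &
  holds L r 0 (count (fun A => true_lits x A == 0) phi).
Proof.
move=> L0 wf sz lt.
(* The count so far plus the number of clauses left stays below 2^L, so the upper half never
   overflows. *)
have gen h r : holds L r 0 h -> h + size phi < 2 ^ L -> exists2 r',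
    acts (cnf_gates n L phi) (layout n x (unit_carry false) r)
    = layout n x (unit_carry false) r' &
    holds L r' 0 (h + count (fun A => true_lits x A == 0) phi).
  elim: phi h r wf sz {lt} => [|A phi IH] h r.
    by exists r; rewrite //= addn0.
  case/andP=> wfA wf /andP[szA sz] hr lt; rewrite /= in lt.
  have [|r1 eq1 h1] := acts_clause x L0 wfA szA _ hr; first lia.
  have [|r2 eq2 h2] := IH _ _ wf sz h1.
    by have := leq_b1 (true_lits x A == 0); lia.
  exists r2; rewrite ?addnA //.
  by rewrite -[cnf_gates _ _ _]/(clause_gates n L A ++ _) acts_cat eq1.
have [|r eqr hr] := @gen 0 (fun=> false) _ lt; first by split; exact: val_bits0.
by exists r.
Qed.

(** * The amplitude of the counting circuit *)

Definition gate_lt (N : nat) (g : gate nat) : bool :=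
  all (fun q => q < N) (gate_qubits g).

Lemma gate_qubits_map (Q Q' : Type) (f : Q -> Q') g :
  gate_qubits (gate_map f g) = map f (gate_qubits g).
Proof. by case: g. Qed.

Lemma gate_wf_map N (o : nat -> 'I_N) g :
  (forall q, q < N -> o q = q :> nat) -> gate_lt N g ->
  gate_wf g -> gate_wf (gate_map o g).
Proof.
rewrite /gate_wf gate_qubits_map => oK /allP lt; rewrite map_inj_in_uniq //.
by move=> p q /lt pN /lt qN /(congr1 val) /=; rewrite !oK.
Qed.

Definition good_gate (N : nat) (g : gate nat) : bool :=
  [&& classical_gate g, gate_wf g & gate_lt N g].

Lemma all_flatten T (p : pred T) ss : all p (flatten ss) = all (all p) ss.
Proof. by elim: ss => //= t ss IH; rewrite all_cat IH. Qed.

Section Good.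
Variables (N n : nat).

Lemma good_inc_up j k : n + (j + k).*2 < N -> all (good_gate N) (inc_up n j k).
Proof.
elim: k j => //= k IH j lt; rewrite IH ?addSnnS // andbT.
rewrite /good_gate /gate_lt /gate_wf /= !inE /carry_qubit /reg_qubit.
rewrite negb_or !andbT; apply/andP; split; last lia.
by rewrite -andbA; apply/and3P; split; apply/eqP; lia.
Qed.

Lemma good_inc_down k : n + k.*2.+1 < N -> all (good_gate N) (inc_down n k).
Proof.
elim: k => //= k IH lt; rewrite IH ?andbT; last lia.
rewrite /good_gate /gate_lt /gate_wf /= !inE /carry_qubit /reg_qubit.
rewrite negb_or !andbT; apply/andP; split.
  by apply/and3P; split; [apply/eqP; lia|lia|lia].
apply/andP; split; last lia.
by rewrite -andbA; apply/and3P; split; apply/eqP; lia.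
Qed.

Lemma good_inc e : 0 < e -> n + e.*2 <= N -> all (good_gate N) (inc n e).
Proof.
case: e => // e _ lt; rewrite /inc all_cat all_rcons /=.
rewrite good_inc_up ?good_inc_down ?andbT //=; try lia.
rewrite /good_gate /gate_lt /gate_wf /= !inE /carry_qubit /reg_qubit !andbT.
by apply/and3P; split; [apply/eqP|..]; lia.
Qed.

Lemma good_nots j k : n + (j + k).*2 <= N -> all (good_gate N) (nots n j k).
Proof.
elim: k j => //= k IH j lt; rewrite IH ?addSnnS // andbT.
by rewrite /good_gate /gate_lt /gate_wf /= /reg_qubit; lia.
Qed.

Lemma good_neg v : n < N -> all (good_gate N) (neg_gates n v).
Proof.
case: v => //= lt; rewrite /good_gate /gate_lt /gate_wf /= /carry_qubit; lia.
Qed.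

Lemma good_clause_lits L A : 0 < L -> n + L.*2 <= N ->
  all (fun l => l.1 < n) A -> all (good_gate N) (clause_lits n L A).
Proof.
move=> L0 lt /allP wf; rewrite /clause_lits all_flatten all_map.
apply/allP => -[i b] /wf ltin; rewrite /= in ltin.
have goodcx : all (good_gate N) [:: GCX i (carry_qubit n 0)].
  rewrite /good_gate /gate_lt /gate_wf /= !inE /carry_qubit !andbT.
  by apply/and3P; split; [apply/eqP|..]; lia.
change (all (good_gate N) (lit_gates n L (i, b))).
by rewrite /lit_gates !all_cat goodcx good_neg -?all_cat ?[all _ _]good_inc //; lia.
Qed.

Lemma good_cnf L phi : 0 < L -> n + L.*2.*2 <= N ->
  all (all (fun l => l.1 < n)) phi -> all (good_gate N) (cnf_gates n L phi).
Proof.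
move=> L0 lt /allP wf; rewrite /cnf_gates all_flatten all_map.
apply/allP => A /wf wfA; change (all (good_gate N) (clause_gates n L A)).
rewrite /clause_gates !all_cat good_clause_lits ?good_nots ?good_neg
  -?all_cat ?[all _ _]good_inc //; lia.
Qed.

End Good.

(** * Hadamard layers around the classical circuit *)

Section Amplitude.
Local Open Scope ring_scope.
Variables (R : realType) (N n : nat) (o : nat -> 'I_N).
Hypothesis oK : forall q, (q < N)%N -> o q = q :> nat.

Definition hlayer (k : nat) : seq (gate nat) := map (@GH nat) (iota 0 k).

Lemma hlayerS k : hlayer k.+1 = rcons (hlayer k) (GH k).
Proof. by rewrite /hlayer -addn1 iotaD map_cat cats1. Qed.

Definition zero_from (k : nat) (b : 'I_N -> bool) : bool :=
  [forall q : 'I_N, (k <= q)%N ==> ~~ b q].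

Let s : complex R := Complex (rsqrt2 R) 0.

Lemma run_circuit_cat (C D : circuit N) (psi : qvec R 'I_N) :
  run_circuit (C ++ D) psi = run_circuit D (run_circuit C psi).
Proof. exact: foldl_cat. Qed.

Lemma run_hlayer_ket0 k b : (k <= N)%N ->
  run_circuit (map (gate_map o) (hlayer k)) (@ket0 R 'I_N) b
  = s ^+ k * (zero_from k b)%:R.
Proof.
elim: k b => [|k IH] b kN.
  rewrite expr0 mul1r /= /ket0; congr (_%:R); congr nat_of_bool.
  apply/eqP/forallP => [-> //|h]; apply/funext => q.
  by apply/negbTE; move: (h q).
rewrite hlayerS map_rcons -cats1 run_circuit_cat /= !IH ?(ltnW kN) //.
have okk := oK kN.
(* Qubit [k] is untouched so far, so the branch in which it is 1 has amplitude 0. *)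
have -> : zero_from k (upd b (o k) true) = false.
  by apply/negbTE/forallPn; exists (o k); rewrite okk leqnn /upd eqxx.
rewrite !mulr0 addr0 mulrA -exprS; congr (_ * _%:R); congr nat_of_bool.
apply/forallP/forallP => h q; apply/implyP => le; move/implyP: (h q); rewrite /upd.
  by rewrite -val_eqE /= okk (gtn_eqF le); apply; exact: ltnW.
case: eqP => // /eqP; rewrite -val_eqE /= okk => ne; apply.
by rewrite ltn_neqAle eq_sym ne.
Qed.

(** At a basis state that vanishes on the first [k] qubits all Hadamard signs are +1, so the layer
    just sums amplitudes over these qubits. *)
Lemma run_hlayer_sum k (psi : qvec R 'I_N) b : (k <= N)%N ->
  (forall q : 'I_N, (q < k)%N -> b q = false) ->
  run_circuit (map (gate_map o) (hlayer k)) psi b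
  = s ^+ k * \sum_(b' : {ffun 'I_N -> bool}
                | [forall q : 'I_N, (k <= q)%N ==> (b' q == b q)]) psi b'.
Proof.
elim: k b => [|k IH] b kN b0.
  rewrite expr0 mul1r (big_pred1 (finfun b)) /=.
    by congr psi; apply/funext => q; rewrite ffunE.
  move=> b'; apply/forallP/eqP => [h|-> q]; last by rewrite ffunE eqxx.
  by apply/ffunP => q; rewrite ffunE; apply/eqP; move: (h q).
rewrite hlayerS map_rcons -cats1 run_circuit_cat /=.
have okk := oK kN.
rewrite !IH ?(ltnW kN) //; last 2 first.
- by move=> q qk; rewrite /upd -val_eqE /= okk (ltn_eqF qk) b0 // ltnW.
- by move=> q qk; rewrite /upd -val_eqE /= okk (ltn_eqF qk) b0 // ltnW.
rewrite b0 ?okk // expr0 mul1r -mulrDr mulrA -exprS; congr (_ * _).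
(* The two branches of the last Hadamard gate are the two values of bit [k] of the summation
   index. *)
rewrite [RHS](bigID (fun b' : {ffun 'I_N -> bool} => b' (o k))) /= addrC.
have agree (v : bool) (b' : {ffun 'I_N -> bool}) :
    [forall q : 'I_N, (k <= q)%N ==> (b' q == upd b (o k) v q)] =
    [forall q : 'I_N, (k < q)%N ==> (b' q == b q)] && (b' (o k) == v).
  apply/forallP/andP => [h|[/forallP h /eqP bv] q].
    split; last by move: (h (o k)); rewrite okk leqnn /upd eqxx.
    apply/forallP => q; apply/implyP => le; move: (h q).
    by rewrite /upd -val_eqE /= okk (gtn_eqF le) (ltnW le).
  apply/implyP => le; rewrite /upd; case: (q =P o k) => [->|/eqP]; first by rewrite bv.
  rewrite -val_eqE /= okk => ne; move: (h q).
  by rewrite ltn_neqAle eq_sym ne le.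
congr (_ + _); apply: eq_bigl => b'; rewrite agree.
  by case: (b' (o k)).
by rewrite eqb_id.
Qed.

Definition extend (a : {ffun 'I_n -> bool}) : nat -> bool :=
  fun q => if insub q is Some i then a i else false.

Lemma extendE a (i : 'I_n) : extend a i = a i.
Proof. by rewrite /extend valK. Qed.

Variables (L : nat) (phi : seq (seq (nat * bool))).
Hypotheses (L0 : (0 < L)%N) (eqN : N = (n + L.*2.*2)%N)
  (wf : all (all (fun l => (l.1 < n)%N)) phi)
  (sz : all (fun A => (size A < 2 ^ L)%N) phi) (szphi : (size phi < 2 ^ L)%N).

Definition sat_seq (x : nat -> bool) : bool :=
  all (has (fun l : nat * bool => x l.1 == l.2)) phi.

Lemma sat_count x : sat_seq x = (count (fun A => true_lits x A == 0) phi == 0)%N.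
Proof.
rewrite -[RHS]negbK -lt0n -has_count -all_predC; apply: eq_all => A /=.
by rewrite -lt0n -has_count.
Qed.

Let Cphi : circuit N := map (gate_map o) (cnf_gates n L phi).

Let emb (x r : nat -> bool) : 'I_N -> bool :=
  fun q => layout n x (unit_carry false) r q.

Let good_Cphi : all (good_gate N) (cnf_gates n L phi).
Proof. by apply: good_cnf => //; rewrite eqN. Qed.

Lemma wf_cnf_circuit : all (@gate_wf _) Cphi.
Proof.
rewrite all_map; apply: sub_all good_Cphi => g /and3P[_ wfg ltg] /=.
exact: gate_wf_map.
Qed.

Lemma classical_cnf_circuit : all (@classical_gate _) Cphi.
Proof. by rewrite all_map; apply: sub_all good_Cphi => -[] //. Qed.

Lemma acts_cnf_circuit x : exists2 r, acts Cphi (emb x (fun=> false)) = emb x r &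
  holds L r 0 (count (fun A => true_lits x A == 0) phi).
Proof.
have [r eqr hr] := acts_cnf x L0 wf sz szphi; exists r => //.
rewrite /emb -eqr /Cphi acts_map //.
apply: sub_all good_Cphi => g /and3P[_ _ ltg].
by apply: sub_all ltg => q /oK ->.
Qed.

(** The lower half always returns to 0, so the state is fixed exactly when the upper half counts no
    falsified clause. *)
Lemma acts_cnf_fixed x :
  (acts Cphi (emb x (fun=> false)) == emb x (fun=> false)) = sat_seq x.
Proof.
have [r -> [hl hh]] := acts_cnf_circuit x; rewrite sat_count.
apply/eqP/eqP => [e|cnt0]; last first.
  have r0 j : (j < L.*2)%N -> r j = false.
    move=> jL; have [jl|lj] := ltnP j L; first exact: val_bits_eq0 hl jl.
    rewrite -(subnKC lj); apply: (val_bits_eq0 (k := L) (r := fun i => r (L + i)%N)).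
      by rewrite hh cnt0.
    by lia.
  apply/funext => q; rewrite /emb /layout; case: ltnP => // nq.
  case: ifP => // _; apply: r0; have := ltn_ord q.
  by move: (nat_of_ord q) nq; rewrite eqN; lia.
rewrite -hh -[RHS](val_bits0 L); apply: eq_val_bits => i iL.
have lt : (reg_qubit n (L + i) < N)%N by rewrite /reg_qubit eqN; lia.
move: (congr1 (fun f => f (Ordinal lt)) e).
by rewrite /emb -[nat_of_ord _]/(reg_qubit n (L + i)) !layout_reg.
Qed.

Lemma zero_from_emb (b : 'I_N -> bool) : zero_from n b ->
  exists a, b = emb (extend a) (fun=> false).
Proof.
move=> /forallP b0; have nN : (n <= N)%N by rewrite eqN leq_addr.
exists [ffun i => b (widen_ord nN i)]; apply/funext => q; rewrite /emb /layout.
case: ltnP => nq; last first.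
  by rewrite /unit_carry andbF if_same; apply/negbTE; move: (b0 q); rewrite nq.
by rewrite -[nat_of_ord q]/(nat_of_ord (Ordinal nq)) extendE ffunE; congr b; apply: val_inj.
Qed.

Lemma emb_zero_from x : zero_from n (emb x (fun=> false)).
Proof.
apply/forallP => q; apply/implyP => nq.
by rewrite /emb /layout ltnNge nq /= /unit_carry andbF if_same.
Qed.

Lemma emb_inj (a a' : {ffun 'I_n -> bool}) r r' :
  emb (extend a) r = emb (extend a') r' -> a = a'.
Proof.
move=> e; apply/ffunP => i; have lt : (i < N)%N.
  by rewrite eqN; have := ltn_ord i; lia.
move: (congr1 (fun f => f (Ordinal lt)) e).
by rewrite /emb /= !layout_var ?extendE.
Qed.

(** The inverse permutation appears because of [run_classical]. If it leads to some |a', 0>, then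
    the circuit maps |a', 0> to |a, 0>; it keeps the variables, so a' = a and the state is fixed. *)
Lemma zero_from_uncompute a :
  zero_from n (acts (rev Cphi) (emb (extend a) (fun=> false))) = sat_seq (extend a).
Proof.
rewrite -acts_cnf_fixed; apply/idP/eqP => [/zero_from_emb[a' e]|e].
  have [r er _] := acts_cnf_circuit (extend a').
  have := acts_revK wf_cnf_circuit (emb (extend a) (fun=> false)).
  by rewrite e er => e'; have aa' := emb_inj e'; move: er e'; rewrite aa' => ->.
by rewrite -e acts_Krev ?emb_zero_from //; exact: wf_cnf_circuit.
Qed.

Definition count_gates : seq (gate nat) := hlayer n ++ cnf_gates n L phi ++ hlayer n.

Lemma rsqrt2_sqr : rsqrt2 R ^+ 2 = 2^-1.
Proof. by rewrite /rsqrt2 exprVn sqr_sqrtr. Qed.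

(** The Hadamard layers contribute the factor 2^-n and leave a sum, over the states |a, 0>, of the
    indicator that the preimage also has all its ancillas at 0. *)
Lemma amplitude_count :
  amplitude_abs R (map (gate_map o) count_gates) (nseq_tuple N false)
  = #|[set a : {ffun 'I_n -> bool} | sat_seq (extend a)]%SET|%:R / 2 ^+ n.
Proof.
have nN : (n <= N)%N by rewrite eqN leq_addr.
rewrite /amplitude_abs /count_gates !map_cat !run_circuit_cat.
rewrite run_hlayer_sum //; last by move=> q _; rewrite tnth_nseq.
under eq_bigr => b' _ do rewrite run_classical ?classical_cnf_circuit // run_hlayer_ket0 //.
rewrite -big_distrr /= mulrA -exprD.
rewrite -natr_sum; set k := (\sum_(_ | _) _)%N.
have -> : k = #|[set a : {ffun 'I_n -> bool} | sat_seq (extend a)]%SET|.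
  (* [e] matches the assignments with the basis states that vanish outside the variables. *)
  pose e (a : {ffun 'I_n -> bool}) := finfun (emb (extend a) (fun=> false)).
  have funE a : (fun q => e a q) = emb (extend a) (fun=> false).
    by apply/funext => q; rewrite ffunE.
  have inj_e : injective e.
    move=> a a' eaa; apply: (@emb_inj a a' (fun=> false) (fun=> false)).
    by rewrite -!funE eaa.
  rewrite -(card_imset _ inj_e) -sum1_card /k big_mkcond [RHS]big_mkcond /=.
  apply: eq_bigr => b' _.
  have zeroE : [forall q : 'I_N, (n <= q)%N ==> (b' q == tnth (nseq_tuple N false) q)]
      = zero_from n b'.
    by apply: eq_forallb => q; rewrite tnth_nseq eqbF_neg.
  rewrite zeroE; case: ifPn => [/zero_from_emb[a ea]|nz].
    rewrite ea zero_from_uncompute.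
    have -> : b' = e a by apply/ffunP => q; rewrite ffunE -ea.
    by rewrite mem_imset // inE; case: (sat_seq _).
  case: imsetP => // -[a _ eb]; move: nz; rewrite eb.
  by rewrite -[X in zero_from n X]/(fun q => e a q) funE emb_zero_from /=.
(* The amplitude is a nonnegative real, hence equal to its modulus. *)
set c := #|_|; have -> : s ^+ (n + n) * c%:R = Complex (c%:R / 2 ^+ n) 0.
  rewrite addnn -mul2n exprM -[s]/((rsqrt2 R)%:C)%C.
  rewrite -!(rmorphXn (real_complex R)) /= rsqrt2_sqr.
  rewrite -(rmorph_nat (real_complex R)) -rmorphM.
  by congr Complex; rewrite mulrC exprVn.
by rewrite /= expr0n addr0 sqrtr_sqr ger0_norm // divr_ge0 ?exprn_ge0.
Qed.

End Amplitude.

(** * A program writing the counting circuit *)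

Section Runs.
Variable R : realType.

(** Deterministic execution with a time bound. One step count serves all continuations and quantum
    states, and the quantum state is preserved, so the register is still in its initial state when
    the simulation starts. *)
Definition runs (c : cmd) (m m' : memory) (B : nat) : Prop :=
  exists2 t, t <= B & forall k (psi : qvec R nat),
    steps t (Config (c :: k) m psi) = [:: Config k m' psi].

Lemma stepsD s t (x y : config R) : steps s x = [:: y] ->
  steps (s + t) x = steps t y.
Proof. by rewrite /steps addnC iterD => ->. Qed.

Lemma stepsS t (x y : config R) : step x = [:: y] -> steps t.+1 x = steps t y.
Proof. by move=> e; rewrite -add1n; apply: stepsD; rewrite /steps /= e. Qed.

Lemma runs_weaken c m m1 m' B B' : runs c m m1 B -> m1 = m' -> B <= B' ->
  runs c m m' B'.
Proof. by case=> t tB ex <- BB'; exists t => //; exact: leq_trans tB BB'. Qed.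

Lemma runs_put a e v m :
  runs (Put a e v) m (write m a (eval m e) (eval m v)) 1.
Proof. by exists 1. Qed.

Lemma runs_skip m : runs Skip m m 1.
Proof. by exists 1. Qed.

Lemma runs_seq c d m m1 m' B1 B2 : runs c m m1 B1 -> runs d m1 m' B2 ->
  runs (Seq c d) m m' (B1 + B2).+1.
Proof.
move=> [s sB exs] [t tB extend]; exists (s + t).+1; first by rewrite ltnS leq_add.
by move=> k psi; rewrite (@stepsS _ _ (Config [:: c, d & k] m psi)) ?(stepsD _ (exs _ _)).
Qed.

Lemma runs_if e c d m m' B : runs (if eval m e != 0 then c else d) m m' B ->
  runs (If e c d) m m' B.+1.
Proof.
move=> [t tB ex]; exists t.+1 => // k psi.
by rewrite (@stepsS _ _ (Config ((if eval m e != 0 then c else d) :: k) m psi)).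
Qed.

Lemma runs_while0 e c m : eval m e = 0 -> runs (While e c) m m 1.
Proof. by move=> e0; exists 1 => // k psi; rewrite /steps /= e0. Qed.

Lemma runs_whileS e c m m1 m' B1 B2 : eval m e != 0 ->
  runs c m m1 B1 -> runs (While e c) m1 m' B2 ->
  runs (While e c) m m' (B1 + B2).+1.
Proof.
move=> e0 [s sB exs] [t tB extend]; exists (s + t).+1; first by rewrite ltnS leq_add.
move=> k psi; rewrite -(extend k psi) -(stepsD _ (exs _ _)).
by apply: stepsS; rewrite /= e0.
Qed.

Fixpoint block (cs : seq cmd) : cmd :=
  if cs is c :: cs' then Seq c (block cs') else Skip.

Lemma runs_nil m : runs (block [::]) m m 1.
Proof. exact: runs_skip. Qed.

Lemma runs_cons c cs m m1 m' B1 B2 : runs c m m1 B1 -> runs (block cs) m1 m' B2 ->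
  runs (block (c :: cs)) m m' (B1 + B2).+1.
Proof. exact: runs_seq. Qed.

End Runs.

Arguments block : simpl never.

(** * Memory of the preparing program and output of gates *)

Section Program.
Variables (R : realType) (A : nat).
Hypothesis A_gt1 : 1 < A.

Local Notation runs := (runs R).

(* Arrays [A] (program variables) and [A.+1] (a copy of the input) are those
   that the simulation program does not use. *)
Definition ram (inp vs out : seq nat) : memory := fun a i =>
  if a == 0 then nth 0 out i else if a == A then nth 0 vs i
  else if a == A.+1 then nth 0 inp i else 0.

(** Cells past the end of a list read as 0, so lists count only up to trailing zeros. *)
Lemma ram_ext inp inp' vs vs' out out' :
  nth 0 inp =1 nth 0 inp' -> nth 0 vs =1 nth 0 vs' -> nth 0 out =1 nth 0 out' ->
  ram inp vs out = ram inp' vs' out'.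
Proof.
by move=> ei ev eo; apply/funext => a; apply/funext => i; rewrite /ram ei ev eo.
Qed.

Let A_neq0 : (A == 0) = false. Proof. by case: A A_gt1. Qed.
Let SA_neqA : (A.+1 == A) = false. Proof. by apply/eqP; lia. Qed.

Lemma ram_out inp vs out i : ram inp vs out 0 i = nth 0 out i.
Proof. by []. Qed.

Lemma ram_var inp vs out i : ram inp vs out A i = nth 0 vs i.
Proof. by rewrite /ram A_neq0 eqxx. Qed.

Lemma ram_inp inp vs out i : ram inp vs out A.+1 i = nth 0 inp i.
Proof. by rewrite /ram /= SA_neqA eqxx. Qed.

Definition ramE := (ram_out, ram_var, ram_inp).

Definition var (i : nat) : expr := Get A (Cst i).
Definition set_var (i : nat) (e : expr) : cmd := Put A (Cst i) e.

Lemma write_out inp vs out i v :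
  write (ram inp vs out) 0 i v = ram inp vs (set_nth 0 out i v).
Proof.
apply/funext => a; apply/funext => j; rewrite /write /upd /ram.
by case: (eqVneq a 0) => // _; rewrite nth_set_nth.
Qed.

Lemma write_var inp vs out i v :
  write (ram inp vs out) A i v = ram inp (set_nth 0 vs i v) out.
Proof.
apply/funext => a; apply/funext => j; rewrite /write /upd /ram.
by case: (eqVneq a A) => [->|//]; rewrite A_neq0 eqxx nth_set_nth.
Qed.

Lemma write_inp inp vs out i v :
  write (ram inp vs out) A.+1 i v = ram (set_nth 0 inp i v) vs out.
Proof.
apply/funext => a; apply/funext => j; rewrite /write /upd /ram.
by case: (eqVneq a A.+1) => [->|//]; rewrite /= SA_neqA eqxx nth_set_nth.
Qed.

Lemma runs_set i e inp vs out :
  runs (set_var i e) (ram inp vs out)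
    (ram inp (set_nth 0 vs i (eval (ram inp vs out) e)) out) 1.
Proof. by rewrite -write_var; exact: runs_put. Qed.

Lemma runs_put_out e v inp vs out :
  runs (Put 0 e v) (ram inp vs out)
    (ram inp vs (set_nth 0 out (eval (ram inp vs out) e) (eval (ram inp vs out) v))) 1.
Proof. by rewrite -write_out; exact: runs_put. Qed.

Lemma runs_put_inp e v inp vs out :
  runs (Put A.+1 e v) (ram inp vs out)
    (ram (set_nth 0 inp (eval (ram inp vs out) e) (eval (ram inp vs out) v)) vs out) 1.
Proof. by rewrite -write_inp; exact: runs_put. Qed.

Definition gate_word (g : gate nat) : seq nat :=
  match g with
  | GX q => [:: 0; q; 0; 0]
  | GH q => [:: 1; q; 0; 0]
  | GT q => [:: 2; q; 0; 0]
  | GCX c t => [:: 3; c; t; 0]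
  | GCCX c1 c2 t => [:: 4; c1; c2; t]
  end.

Lemma size_gate_words gs : size (flatten (map gate_word gs)) = 4 * size gs.
Proof. by elim: gs => [|g gs IH] //=; rewrite size_cat IH mulnS; case: g. Qed.

Lemma set_nth_size (s : seq nat) v : set_nth 0 s (size s) v = rcons s v.
Proof. by elim: s => //= x s ->. Qed.

Definition emit (op : nat) (e1 e2 e3 : expr) : cmd :=
  block [:: Put 0 (var 3) (Cst op); Put 0 (Succ (var 3)) e1;
            Put 0 (Succ (Succ (var 3))) e2; Put 0 (Succ (Succ (Succ (var 3)))) e3;
            set_var 3 (Succ (Succ (Succ (Succ (var 3))))); set_var 4 (Succ (var 4))].

Section State.
Variables (inp base : seq nat).

(* The variables are, in this order: n, the number of remaining clauses, the
   input position, the output position, the number of gates written, L, 2 L, a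
   loop counter, a qubit, a value being halved and its half, the input position
   of the current clause, and the output position of the number of gates. *)
Definition state (gs : seq (gate nat)) (n c i L T k p v h s z : nat) : memory :=
  ram inp [:: n; c; i; size base + 4 * size gs; size gs; L; T; k; p; v; h; s; z]
    (base ++ flatten (map gate_word gs)).

Ltac next lem := eapply runs_cons; [eapply lem|rewrite /= /state ?ramE /=].
Ltac finish := eapply runs_nil.

(** Quantifying over the output array, the output position and the gate count ensures that the
    operands keep their values while earlier cells of the gate are written. *)
Lemma runs_emit g op e1 e2 e3 gs n c i L T k p v h s z :
  (forall x y out, let m := ram inp [:: n; c; i; x; y; L; T; k; p; v; h; s; z] out in
     gate_word g = [:: op; eval m e1; eval m e2; eval m e3]) ->
  runs (emit op e1 e2 e3) (state gs n c i L T k p v h s z)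
    (state (gs ++ [:: g]) n c i L T k p v h s z) 13.
Proof.
move=> wordg; rewrite /emit /state.
set x := size base + _; set y := size gs.
have xE : x = size (base ++ flatten [seq gate_word g | g <- gs]).
  by rewrite size_cat size_gate_words.
pose m out := ram inp [:: n; c; i; x; y; L; T; k; p; v; h; s; z] out.
have [] : [/\ forall out, eval (m out) e1 = eval (m [::]) e1,
  forall out, eval (m out) e2 = eval (m [::]) e2 &
  forall out, eval (m out) e3 = eval (m [::]) e3].
  by split=> out; move: (wordg x y out); rewrite /= (wordg x y [::]) => -[].
move=> ev1 ev2 ev3.
eapply runs_weaken.
  next runs_put_out. next runs_put_out. next runs_put_out. next runs_put_out.
  next runs_set. next runs_set. finish.
2: by [].
rewrite ev1 ev2 ev3 xE.
set r1 := eval _ e1; set r2 := eval _ e2; set r3 := eval _ e3.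
rewrite set_nth_size -(size_rcons _ op) set_nth_size -(size_rcons _ r1).
rewrite set_nth_size -(size_rcons _ r2) set_nth_size.
rewrite map_cat flatten_cat /= (wordg x y [::]) -!cats1 -!catA /=.
congr ram.
rewrite !size_cat /= size_gate_words /y !addn1 mulnS.
by congr [:: _, _, _, _ & _]; lia.
Qed.

(** The qubit pointer in variable 8 climbs from carry 0 to the last carry and returns; variable 7
    counts the rounds. *)
Definition inc_cmd (e : expr) : cmd :=
  block [:: set_var 7 (Pred e); set_var 8 (var 0);
    While (var 7) (block [::
      emit 4 (var 8) (Succ (var 8)) (Succ (Succ (var 8)));
      set_var 8 (Succ (Succ (var 8))); set_var 7 (Pred (var 7))]);
    set_var 7 (Pred e);
    While (var 7) (block [::
      emit 3 (var 8) (Succ (var 8)) (Cst 0); set_var 8 (Pred (Pred (var 8)));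
      emit 4 (var 8) (Succ (var 8)) (Succ (Succ (var 8))); set_var 7 (Pred (var 7))]);
    emit 3 (var 8) (Succ (var 8)) (Cst 0)].

Lemma carry_qubitS n j : carry_qubit n j.+1 = (carry_qubit n j).+2.
Proof. by rewrite /carry_qubit doubleS !addnS. Qed.

Lemma runs_inc_up gs n c i L T k j p v h s z : p = carry_qubit n j ->
  runs (While (var 7) (block [::
      emit 4 (var 8) (Succ (var 8)) (Succ (Succ (var 8)));
      set_var 8 (Succ (Succ (var 8))); set_var 7 (Pred (var 7))]))
    (state gs n c i L T k p v h s z)
    (state (gs ++ inc_up n j k) n c i L T 0 (carry_qubit n (j + k)) v h s z) (21 * k).+1.
Proof.
move=> ->{p}; elim: k j gs => [|k IH] j gs.
  eapply runs_weaken; first by apply: runs_while0; rewrite /= /state ramE.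
    by rewrite cats0 addn0.
  by [].
eapply runs_weaken.
  eapply runs_whileS; first by rewrite /= /state ramE.
    next (runs_emit (g := GCCX (carry_qubit n j) (reg_qubit n j) (carry_qubit n j.+1))).
      move=> x y out; by rewrite /= !ramE /= carry_qubitS.
    next runs_set. next runs_set. finish.
  by rewrite -carry_qubitS; exact: IH.
- by rewrite -catA addSnnS.
- by lia.
Qed.

Lemma runs_inc_down gs n c i L T k v h s z :
  runs (While (var 7) (block [::
      emit 3 (var 8) (Succ (var 8)) (Cst 0); set_var 8 (Pred (Pred (var 8)));
      emit 4 (var 8) (Succ (var 8)) (Succ (Succ (var 8))); set_var 7 (Pred (var 7))]))
    (state gs n c i L T k (carry_qubit n k) v h s z)
    (state (gs ++ inc_down n k) n c i L T 0 (carry_qubit n 0) v h s z) (35 * k).+1.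
Proof.
elim: k gs => [|k IH] gs.
  eapply runs_weaken; first by apply: runs_while0; rewrite /= /state ramE.
    by rewrite cats0.
  by [].
eapply runs_weaken.
  eapply runs_whileS; first by rewrite /= /state ramE.
    next (runs_emit (g := GCX (carry_qubit n k.+1) (reg_qubit n k.+1))).
      by move=> x y out; rewrite /= !ramE.
    next runs_set. rewrite carry_qubitS /=.
    next (runs_emit (g := GCCX (carry_qubit n k) (reg_qubit n k) (carry_qubit n k.+1))).
      by move=> x y out; rewrite /= !ramE /= carry_qubitS.
    next runs_set. finish.
  exact: IH.
- by rewrite -!catA /= carry_qubitS.
- by lia.
Qed.

(** The variable [d] holding the length must survive [emit], which changes variables 3 and 4, and
    the loops, which change 7 and 8. It is 5 or 6 in the applications. *)
Lemma runs_inc d e gs n c i L T k p v h s z : 0 < e ->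
  nth 0 [:: n; c; i; 0; 0; L; T] d = e -> d != 3 -> d != 4 -> d < 7 ->
  runs (inc_cmd (var d)) (state gs n c i L T k p v h s z)
    (state (gs ++ inc n e) n c i L T 0 (carry_qubit n 0) v h s z) (100 * e).
Proof.
case: e => // e _ de d3 d4 d7.
have nthd x y t : nth 0 ([:: n, c, i, x, y, L, T & t]) d = e.+1.
  by move: d de d3 d4 d7 => [|[|[|[|[|[|[|]]]]]]].
eapply runs_weaken.
  eapply runs_cons; first by eapply runs_set.
  rewrite [eval _ _]/= ram_var nthd /=.
  next runs_set.
  eapply runs_cons.
    by apply: (@runs_inc_up _ _ _ _ _ _ _ 0); rewrite /carry_qubit addn0.
  eapply runs_cons; first by eapply runs_set.
  rewrite [eval _ _]/= ram_var nthd /=.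
  eapply runs_cons; first exact: runs_inc_down.
  next (runs_emit (g := GCX (carry_qubit n 0) (reg_qubit n 0))).
    by move=> x y out; rewrite /= !ramE.
  finish.
- by rewrite /inc -cats1 -!catA.
- by lia.
Qed.

(** Repeated subtraction of 2 splits the predecessor of a literal code into its sign (variable 9)
    and index (variable 10), and also serves to find bit lengths. *)
Definition halve : cmd :=
  While (Leq (Cst 2) (var 9))
    (block [:: set_var 9 (Pred (Pred (var 9))); set_var 10 (Succ (var 10))]).

Lemma runs_halve gs n c i L T k p v h s z :
  runs halve (state gs n c i L T k p v h s z)
    (state gs n c i L T k p (odd v) (h + v./2) s z) (3 * v).+1.
Proof.
rewrite -{1 4}(odd_double_half v); elim: v./2 h (odd v) => [|q IH] h' b.
  eapply runs_weaken; first by apply: runs_while0; rewrite /= /state ramE; case: b.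
    by rewrite !addn0.
  by [].
eapply runs_weaken.
  eapply runs_whileS; first by rewrite /= /state ramE /=; case: b.
    next runs_set. next runs_set. finish.
  have -> : (b + (q.+1).*2).-2 = b + q.*2 by case: b.
  exact: IH.
- by rewrite addSnnS.
- by lia.
Qed.

Definition neg_cmd : cmd :=
  If (var 9) Skip (emit 0 (var 0) (Cst 0) (Cst 0)).

Lemma runs_neg gs n c i L T k p (b : bool) h s z :
  runs neg_cmd (state gs n c i L T k p b h s z)
    (state (gs ++ neg_gates n b) n c i L T k p b h s z) 14.
Proof.
have e9 : eval (state gs n c i L T k p b h s z) (var 9) = b by rewrite /= /state ramE.
rewrite /neg_cmd; apply: runs_if; rewrite {}e9; case: b => /=.
  by rewrite cats0; eapply runs_weaken; first exact: runs_skip.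
eapply runs_weaken; first eapply (runs_emit (g := GX (carry_qubit n 0))).
- by move=> x y out; rewrite /= !ramE /= /carry_qubit addn0.
- by [].
- by [].
Qed.

Definition lit_code (l : nat * bool) : nat := (l.1.*2 + l.2).+1.

Definition lit_cmd : cmd :=
  block [:: set_var 9 (Pred (Get A.+1 (var 2))); set_var 10 (Cst 0); halve;
    emit 3 (var 10) (var 0) (Cst 0); neg_cmd; inc_cmd (var 5); neg_cmd;
    emit 3 (var 10) (var 0) (Cst 0); set_var 2 (Succ (var 2))].

Lemma runs_lit l gs n c i L T k p v h s z :
  0 < L -> nth 0 inp i = lit_code l ->
  runs lit_cmd (state gs n c i L T k p v h s z)
    (state (gs ++ lit_gates n L l) n c i.+1 L T 0 (carry_qubit n 0) l.2 l.1 s z)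
    (6 * l.1 + 100 * L + 90).
Proof.
case: l => [q b] L0 codeE; eapply runs_weaken.
  next runs_set. rewrite codeE /=. next runs_set.
  eapply runs_cons; first exact: runs_halve.
  have -> : odd (q.*2 + b) = b by rewrite oddD odd_double oddb.
  have -> : (q.*2 + b)./2 = q by rewrite addnC half_bit_double.
  next (runs_emit (g := GCX q (carry_qubit n 0))).
    by move=> x y out; rewrite /= !ramE /= /carry_qubit addn0.
  eapply runs_cons; first exact: runs_neg.
  eapply runs_cons; first by apply: (runs_inc (e := L)).
  eapply runs_cons; first exact: runs_neg.
  next (runs_emit (g := GCX q (carry_qubit n 0))).
    by move=> x y out; rewrite /= !ramE /= /carry_qubit addn0.
  next runs_set. finish.
- by rewrite /lit_gates -!catA.
- by rewrite /=; lia.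
Qed.

(** Each clause is read twice, so the reading restarts from the saved position in variable 11; the
    terminating 0 stops the loop. *)
Definition lits_cmd : cmd :=
  block [:: set_var 2 (var 11); While (Get A.+1 (var 2)) lit_cmd].

Lemma drop_cons i x t : drop i inp = x :: t ->
  nth 0 inp i = x /\ drop i.+1 inp = t.
Proof.
move=> e; split; first by have := nth_drop i 0 inp 0; rewrite e addn0.
by rewrite -add1n -drop_drop e /= drop0.
Qed.

Lemma runs_lit_loop ls rest S gs n c i L T k p v h s z :
  0 < L -> n <= S -> L <= S -> all (fun l => l.1 < n) ls ->
  drop i inp = rcons (map lit_code ls) 0 ++ rest ->
  exists k' p' v' h', runs (While (Get A.+1 (var 2)) lit_cmd)
    (state gs n c i L T k p v h s z)
    (state (gs ++ clause_lits n L ls) n c (i + size ls) L T k' p' v' h' s z)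
    (size ls * (200 * S)).+1.
Proof.
move=> L0 nS LS; elim: ls gs i k p v h => [|l ls IH] gs i k p v h /=.
  move=> _ /drop_cons[i0 _]; exists k, p, v, h.
  eapply runs_weaken; first by apply: runs_while0; rewrite /= /state !ramE /= ?ramE.
    by rewrite cats0 addn0.
  by [].
case/andP => lt wf /drop_cons[il dr].
have [k' [p' [v' [h' r]]]] :=
  IH (gs ++ lit_gates n L l) i.+1 0 (carry_qubit n 0) l.2 l.1 wf dr.
exists k', p', v', h'; eapply runs_weaken.
  eapply runs_whileS; first by rewrite /= /state !ramE /= ?ramE il.
    exact: (runs_lit (l := l)).
  exact: r.
- by rewrite -catA addSnnS.
- by rewrite mulSn; lia.
Qed.

Lemma runs_lits ls rest S gs n c i L T k p v h s z :
  0 < L -> n <= S -> L <= S -> all (fun l => l.1 < n) ls ->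
  drop s inp = rcons (map lit_code ls) 0 ++ rest ->
  exists k' p' v' h', runs lits_cmd
    (state gs n c i L T k p v h s z)
    (state (gs ++ clause_lits n L ls) n c (s + size ls) L T k' p' v' h' s z)
    (size ls * (200 * S) + 5).
Proof.
move=> L0 nS LS wf dr.
have [k' [p' [v' [h' r]]]] := runs_lit_loop gs c T k p v h s z L0 nS LS wf dr.
exists k', p', v', h'; eapply runs_weaken.
  next runs_set. eapply runs_cons; first exact: r. finish.
- by [].
- lia.
Qed.

Definition clause_cmd : cmd :=
  block [:: set_var 11 (var 2); lits_cmd; set_var 7 (var 5); set_var 8 (Succ (var 0));
    While (var 7) (block [:: emit 0 (var 8) (Cst 0) (Cst 0);
      set_var 8 (Succ (Succ (var 8))); set_var 7 (Pred (var 7))]);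
    emit 0 (var 0) (Cst 0) (Cst 0); inc_cmd (var 6); emit 0 (var 0) (Cst 0) (Cst 0);
    lits_cmd; set_var 2 (Succ (var 2)); set_var 1 (Pred (var 1))].

Lemma runs_nots gs n c i L T k j p v h s z : p = reg_qubit n j ->
  runs (While (var 7) (block [:: emit 0 (var 8) (Cst 0) (Cst 0);
      set_var 8 (Succ (Succ (var 8))); set_var 7 (Pred (var 7))]))
    (state gs n c i L T k p v h s z)
    (state (gs ++ nots n j k) n c i L T 0 (reg_qubit n (j + k)) v h s z) (20 * k).+1.
Proof.
move=> ->{p}; elim: k j gs => [|k IH] j gs.
  eapply runs_weaken; first by apply: runs_while0; rewrite /= /state ramE.
    by rewrite cats0 addn0.
  by [].
eapply runs_weaken.
  eapply runs_whileS; first by rewrite /= /state ramE.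
    next (runs_emit (g := GX (reg_qubit n j))).
      by move=> x y out; rewrite /= !ramE /=.
    next runs_set. next runs_set. finish.
  have -> : (reg_qubit n j).+2 = reg_qubit n j.+1 by rewrite /reg_qubit doubleS !addnS.
  exact: IH.
- by rewrite -catA addSnnS.
- by lia.
Qed.

Lemma runs_clause ls rest S gs n c i L k p v h s z :
  0 < L -> n <= S -> L <= S -> size ls <= S -> all (fun l => l.1 < n) ls ->
  drop i inp = rcons (map lit_code ls) 0 ++ rest ->
  exists k' p' v' h' s', runs clause_cmd
    (state gs n c.+1 i L L.*2 k p v h s z)
    (state (gs ++ clause_gates n L ls) n c (i + size ls).+1 L L.*2 k' p' v' h' s' z)
    (1000 * S ^ 2).
Proof.
move=> L0 nS LS szS wf dr.
have [k1 [p1 [v1 [h1 r1]]]] :=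
  runs_lits gs c.+1 i L.*2 k p v h z L0 nS LS wf dr.
pose gs' := ((((gs ++ clause_lits n L ls) ++ nots n 0 L) ++ [:: GX (carry_qubit n 0)])
  ++ inc n L.*2) ++ [:: GX (carry_qubit n 0)].
have [k2 [p2 [v2 [h2 r2]]]] :=
  runs_lits gs' c.+1 (i + size ls) L.*2 0 (carry_qubit n 0) v1 h1 z L0 nS LS wf dr.
exists k2, p2, v2, h2, i; eapply runs_weaken.
  next runs_set. eapply runs_cons; first exact: r1.
  next runs_set. next runs_set. 
  eapply runs_cons.
    by apply: (@runs_nots _ _ _ _ _ _ _ 0); rewrite /reg_qubit addn0.
  next (runs_emit (g := GX (carry_qubit n 0))).
    by move=> x y out; rewrite /= !ramE /= /carry_qubit addn0.
  eapply runs_cons; first by apply: (runs_inc (e := L.*2)); rewrite ?double_gt0.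
  next (runs_emit (g := GX (carry_qubit n 0))).
    by move=> x y out; rewrite /= !ramE /= /carry_qubit addn0.
  eapply runs_cons; first exact: r2.
  next runs_set. next runs_set. finish.
- by rewrite /clause_gates /gs' -!catA.
- have : size ls * (200 * S) <= 200 * S ^ 2.
    by rewrite mulnCA leq_mul2l /= expnS expn1 leq_mul2r szS orbT.
  have : S <= S ^ 2 by rewrite expnS expn1 leq_pmulr //; lia.
  lia.
Qed.

Definition cnf_cmd : cmd := While (var 1) clause_cmd.

Lemma runs_cnf phi S gs n i L k p v h s z :
  0 < L -> n <= S -> L <= S -> all (fun ls => size ls <= S) phi ->
  all (all (fun l => l.1 < n)) phi ->
  drop i inp = flatten [seq rcons (map lit_code ls) 0 | ls <- phi] ->
  exists i' k' p' v' h' s', runs cnf_cmd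
    (state gs n (size phi) i L L.*2 k p v h s z)
    (state (gs ++ cnf_gates n L phi) n 0 i' L L.*2 k' p' v' h' s' z)
    (size phi * (1001 * S ^ 2)).+1.
Proof.
move=> L0 nS LS; elim: phi gs i k p v h s => [|ls phi IH] gs i k p v h s.
  move=> _ _ _; exists i, k, p, v, h, s.
  eapply runs_weaken; first by apply: runs_while0; rewrite /= /state ramE.
    by rewrite cats0.
  by [].
case/andP=> sz szs /andP[wf wfs] dr; rewrite /= in dr.
have [k1 [p1 [v1 [h1 [s1 r1]]]]] :=
  runs_clause gs (size phi) k p v h s z L0 nS LS sz wf dr.
have [|i' [k2 [p2 [v2 [h2 [s2 r2]]]]]] :=
  IH (gs ++ clause_gates n L ls) (i + size ls).+1 k1 p1 v1 h1 s1 szs wfs.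
  have -> : (i + size ls).+1 = i + size (rcons (map lit_code ls) 0).
    by rewrite size_rcons size_map addnS.
  by rewrite addnC -drop_drop dr drop_size_cat.
exists i', k2, p2, v2, h2, s2; eapply runs_weaken.
  eapply runs_whileS; first by rewrite /= /state ramE.
    exact: r1.
  exact: r2.
- by rewrite -catA.
- have S0 : 0 < S ^ 2 by rewrite expn_gt0; lia.
  by rewrite /= mulSn; lia.
Qed.

Definition hlayer_cmd : cmd :=
  block [:: set_var 7 (Cst 0); While (Leq (Succ (var 7)) (var 0))
    (block [:: emit 1 (var 7) (Cst 0) (Cst 0); set_var 7 (Succ (var 7))])].

Lemma runs_hlayer gs n c i L T k p v h s z :
  runs hlayer_cmd (state gs n c i L T k p v h s z)
    (state (gs ++ hlayer n) n c i L T n p v h s z) (20 * n + 10).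
Proof.
have loop r j gs' : j + r = n ->
  runs (While (Leq (Succ (var 7)) (var 0))
    (block [:: emit 1 (var 7) (Cst 0) (Cst 0); set_var 7 (Succ (var 7))]))
    (state gs' n c i L T j p v h s z)
    (state (gs' ++ map (@GH nat) (iota j r)) n c i L T n p v h s z) (20 * r).+1.
  elim: r j gs' => [|r IH] j gs' jr.
    eapply runs_weaken; first by apply: runs_while0; rewrite /= /state !ramE /=; lia.
      by rewrite cats0; congr state; lia.
    by [].
  eapply runs_weaken.
    eapply runs_whileS; first by rewrite /= /state !ramE /=; lia.
      next (runs_emit (g := GH j)).
        by move=> x y out; rewrite /= !ramE.
      next runs_set. finish.
    by apply: IH; lia.
  - by rewrite -catA.
  - by lia.
eapply runs_weaken.
  next runs_set. eapply runs_cons; first exact: (loop n 0). finish.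
- by [].
- lia.
Qed.

(** Each halving raises L by 1, 2 L by 2 and variable 12 by 4. Started at n, variable 12 ends as the
    number n + 4 L of qubits, without any multiplication. *)
Definition bitlen_cmd : cmd :=
  While (var 9) (block [:: set_var 10 (Cst 0); halve; set_var 9 (var 10);
    set_var 5 (Succ (var 5)); set_var 6 (Succ (Succ (var 6)));
    set_var 12 (Succ (Succ (Succ (Succ (var 12)))))]).

(** One halving takes time linear in the value, and the geometric series keeps the total linear. The
    maximum with 1 covers [v] = 0. *)
Lemma runs_bitlen gs n c i L k p v h s z : exists l h',
  [/\ v < 2 ^ l, 2 ^ l <= maxn 1 v.*2 & runs bitlen_cmd
    (state gs n c i L L.*2 k p v h s z)
    (state gs n c i (L + l) (L + l).*2 k p 0 h' s (z + l.*2.*2)) (50 * v).+1].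
Proof.
have [N] := ubnP v; elim: N v L h z => // N IH [|v] L h z.
  move=> _; exists 0, h; split=> //.
  eapply runs_weaken; first by apply: runs_while0; rewrite /= /state ramE.
    by rewrite !addn0.
  by [].
move=> vN; have lt : v.+1./2 < N by lia.
have [l [h' [vl lv r]]] := IH _ L.+1 v.+1./2 z.+4 lt.
exists l.+1, h'; split.
- rewrite expnS; have := odd_double_half v.+1; case: (odd _) => /=; lia.
- rewrite expnS; have := odd_double_half v.+1; case: (odd _) => /=; lia.
eapply runs_weaken.
  eapply runs_whileS; first by rewrite /= /state ramE.
    next runs_set. eapply runs_cons; first exact: runs_halve. rewrite add0n.
    next runs_set. next runs_set. next runs_set. next runs_set. finish.
  exact: r.
- by congr state; lia.
- lia.
Qed.

End State.

(** * Moving the input and writing the whole word *)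

Lemma nth_take0 (w : seq nat) j i : nth 0 (take j w) i = if i < j then nth 0 w i else 0.
Proof.
case: ltnP => ij; first exact: nth_take.
by rewrite nth_default // size_take_min; lia.
Qed.

Lemma nth_nseq_drop (w : seq nat) j i :
  nth 0 (nseq j 0 ++ drop j w) i = if i < j then 0 else nth 0 w i.
Proof.
rewrite nth_cat size_nseq; case: ltnP => ij; first by rewrite nth_nseq ij.
by rewrite nth_drop subnKC.
Qed.

(** Array 0 must later hold the circuit, so the formula is moved away and its cells are cleared. *)
Definition copy_cell : cmd :=
  block [:: Put A.+1 (var 2) (Get 0 (var 2)); Put 0 (var 2) (Cst 0);
    set_var 2 (Succ (var 2))].

Ltac next lem := eapply runs_cons; [eapply lem|rewrite /= /state ?ramE /=].
Ltac finish := eapply runs_nil.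

Lemma runs_copy_cell w j vs : nth 0 vs 2 = j ->
  runs copy_cell (ram (take j w) vs (nseq j 0 ++ drop j w))
    (ram (take j.+1 w) (set_nth 0 vs 2 j.+1) (nseq j.+1 0 ++ drop j.+1 w)) 7.
Proof.
move=> vj; eapply runs_weaken.
  next runs_put_inp. next runs_put_out. next runs_set. finish.
- rewrite vj; apply: ram_ext => // i.
    rewrite nth_set_nth /= !nth_take0 nth_nseq_drop ltnn ltnS.
    by case: ltngtP => // ->.
  rewrite nth_set_nth /= -[0 :: _]/(nseq j.+1 0 ++ _) !nth_nseq_drop ltnS.
  by case: ltngtP.
- by [].
Qed.

(** The end of the input is found by counting terminators: variable 1 starts at the number of
    clauses and drops at each 0. *)
Definition copy_loop : cmd :=
  While (var 1) (block [:: If (Get 0 (var 2)) Skip (set_var 1 (Pred (var 1))); copy_cell]).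

Lemma runs_copy_loop w j t n : drop j w = t -> last 0 t = 0 ->
  runs copy_loop
    (ram (take j w) [:: n; count_mem 0 t; j; 0; 0; 0; 0; 0; 0; 0; 0; 0; 0]
       (nseq j 0 ++ drop j w))
    (ram w [:: n; 0; j + size t; 0; 0; 0; 0; 0; 0; 0; 0; 0; 0] [::])
    (20 * size t).+1.
Proof.
elim: t j => [|x t IH] j dr lst.
  eapply runs_weaken; first by apply: runs_while0; rewrite /= ramE.
    rewrite addn0; have sz : size w <= j by rewrite -subn_eq0 -size_drop dr.
    rewrite take_oversize // dr cats0; apply: ram_ext => // i.
    by rewrite nth_nseq nth_nil if_same.
  by [].
have dr' : drop j.+1 w = t by rewrite -add1n -drop_drop dr /= drop0.
have wj : nth 0 w j = x by have := nth_drop j 0 w 0; rewrite dr addn0.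
have lst' : last 0 t = 0 by case: t lst {IH dr dr'}.
(* A nonempty rest of the word ends with a terminator, so the loop is not over. *)
have nz : count_mem 0 (x :: t) != 0.
  by rewrite -lt0n -has_count has_pred1 -[X in X \in _]lst /= mem_last.
eapply runs_weaken.
  eapply runs_whileS; first by rewrite /= ramE.
    eapply runs_cons.
      have : runs (If (Get 0 (var 2)) Skip (set_var 1 (Pred (var 1))))
        (ram (take j w) [:: n; count_mem 0 (x :: t); j; 0; 0; 0; 0; 0; 0; 0; 0; 0; 0]
          (nseq j 0 ++ drop j w))
        (ram (take j w) [:: n; count_mem 0 t; j; 0; 0; 0; 0; 0; 0; 0; 0; 0; 0]
          (nseq j 0 ++ drop j w)) 2.
        apply: runs_if; rewrite [eval _ _]/= ram_var ram_out nth_nseq_drop ltnn wj.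
        case: (eqVneq x 0) => [->|x0].
          by eapply runs_weaken; [eapply runs_set|rewrite /= ramE|].
        by eapply runs_weaken; [eapply runs_skip|rewrite /= (negbTE x0)|].
      by move=> r; exact: r.
    eapply runs_cons; first exact: runs_copy_cell. finish.
  by apply: IH.
- by rewrite addSnnS.
- rewrite /=; lia.
Qed.

Lemma set_nth_nseq N v (s : seq nat) :
  set_nth 0 (nseq N.+1 0 ++ s) N v = nseq N 0 ++ v :: s.
Proof. by elim: N => //= N ->. Qed.

(** The target word consists of N, then N zeros for the basis state, the gate count in cell N + 1,
    and the gates from cell N + 2. The gate count is known, and written, last. *)
Definition prep_cmd : cmd :=
  block [:: set_var 0 (Get 0 (Cst 0)); set_var 1 (Get 0 (Cst 1));
    copy_cell; copy_cell; copy_loop;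
    set_var 1 (Get A.+1 (Cst 1)); set_var 9 (var 2); set_var 12 (var 0); bitlen_cmd;
    Put 0 (Cst 0) (var 12); set_var 12 (Succ (var 12)); set_var 3 (Succ (var 12));
    hlayer_cmd; set_var 2 (Cst 2); cnf_cmd; hlayer_cmd; Put 0 (var 12) (var 4)].

Definition cnf_word (n : nat) (phi : seq (seq (nat * bool))) : seq nat :=
  [:: n, size phi & flatten [seq rcons (map lit_code ls) 0 | ls <- phi]].

Lemma count_cnf_word phi :
  count_mem 0 (flatten [seq rcons (map lit_code ls) 0 | ls <- phi]) = size phi.
Proof.
elim: phi => //= ls phi IH; rewrite count_cat IH -cats1 count_cat /= addn0.
rewrite count_map (eq_count (a2 := pred0)) ?count_pred0 //.
Qed.

Lemma last_cnf_word phi :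
  last 0 (flatten [seq rcons (map lit_code ls) 0 | ls <- phi]) = 0.
Proof. by elim: phi => //= ls phi IH; rewrite last_cat last_rcons. Qed.

Lemma runs_prep n phi : all (all (fun l => l.1 < n)) phi ->
  let w := cnf_word n phi in
  exists L vs, let gs := count_gates n L phi in let N := n + L.*2.*2 in
  [/\ size w < 2 ^ L, 2 ^ L <= (size w).*2 &
   runs prep_cmd (ram [::] [::] w)
     (ram w vs (N :: nseq N 0 ++ size gs :: flatten (map gate_word gs)))
     (3000 * (n + (size w).*2) ^ 3)].
Proof.
move=> wf w; set W := size w; have W2 : 2 <= W by [].
(* Taking for L the bit length of the input length puts 2^L above the number of clauses and every
   clause size. *)
have [L [h1 [WL LW rL]]] := runs_bitlen w [::] [::] n (size phi) W 0 0 0 W 0 0 n.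
rewrite (maxn_idPr _) in LW; last lia.
have LS : L <= n + W.*2.
  by apply: (leq_trans (ltnW (ltn_expl L (ltnSn 1)))); lia.
have L0 : 0 < L by case: L WL {LW rL LS} => //; lia.
have szs : all (fun ls : seq (nat * bool) => size ls <= n + W.*2) phi.
  suff : all (fun ls : seq (nat * bool) => size ls <= W) phi.
    by apply: sub_all => ls; lia.
  rewrite /W /w /=; elim: phi {wf w W W2 WL LW rL LS} => //= ls phi IH.
  rewrite size_cat size_rcons size_map; apply/andP; split; first lia.
  by apply: sub_all IH => ls'; lia.
pose N := n + L.*2.*2; pose base := N :: nseq N.+1 0.
have [i' [k' [p' [v' [h' [s' r]]]]]] :=
  @runs_cnf w base phi (n + W.*2) ([::] ++ hlayer n) n 2 L n 0 0 h1 0 N.+1 L0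
   (leq_addr _ _) LS szs wf (drop0 _).
exists L; eexists; split=> //.
eapply runs_weaken.
  next runs_set. next runs_set.
  have -> : ram [::] [:: n; size phi] w =
    ram (take 0 w) [:: n; size phi] (nseq 0 0 ++ drop 0 w) by rewrite take0 drop0.
  eapply runs_cons; first exact: runs_copy_cell. rewrite [set_nth _ _ _ _]/=.
  eapply runs_cons; first exact: runs_copy_cell. rewrite [set_nth _ _ _ _]/=.
  (* The number of clauses becomes the number of zeros in the rest of the word, as [runs_copy_loop]
     expects, and unset variables are spelled out as 0. *)
  have -> : ram (take 2 w) [:: n; size phi; 2] (nseq 2 0 ++ drop 2 w) =
     ram (take 2 w) [:: n; count_mem 0 (drop 2 w); 2; 0; 0; 0; 0; 0; 0; 0; 0; 0; 0]
      (nseq 2 0 ++ drop 2 w).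
    rewrite /w /= drop0 count_cnf_word; apply: ram_ext => // i.
    by do 13?[case: i => [|i] //=]; rewrite nth_nil.
  eapply runs_cons.
    by apply: runs_copy_loop => //; rewrite /w /= drop0 last_cnf_word.
  have -> : 2 + size (drop 2 w) = W by rewrite size_drop subnKC.
  next runs_set. next runs_set. next runs_set.
  eapply runs_cons; first exact: rL.
  next runs_put_out. next runs_set. next runs_set.
  (* The cells of the basis state and of the gate count are still unwritten and read as 0, so they
     can be included in [base]. *)
  have -> : ram w [:: n; size phi; W; N.+2; 0; 0 + L; (0 + L).*2; 0; 0; 0; h1; 0; N.+1] [:: N]
     = state w base [::] n (size phi) W L L.*2 0 0 0 h1 0 N.+1.
    have szb : size base + 4 * size ([::] : seq (gate nat)) = N.+2.
      by rewrite muln0 addn0 -[size base]/(size (nseq N.+1 0)).+1 size_nseq.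
    rewrite /state szb [flatten _]/= cats0 !add0n; apply: ram_ext => // i.
    case: i => [//|i].
    rewrite -[LHS]/(nth 0 [::] i) -[RHS]/(nth 0 (nseq N.+1 0) i).
    by rewrite nth_nil nth_nseq if_same.
  eapply runs_cons; first exact: runs_hlayer.
  next runs_set.
  eapply runs_cons; first exact: r.
  eapply runs_cons; first exact: runs_hlayer.
  next runs_put_out. finish.
- by rewrite -!catA -[0 :: nseq N 0 ++ _]/(nseq N.+1 0 ++ _) set_nth_nseq.
- have phiW : size phi <= W.
    rewrite -(count_cnf_word phi) (leq_trans (count_size _ _)) //.
    by rewrite /W /w /=; lia.
  set S := n + W.*2.
  have c1 : size phi * (1001 * S ^ 2) <= 1001 * S ^ 3.
    by rewrite mulnCA (expnS S 2) leq_mul2l /= leq_mul2r; apply/orP; right; lia.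
  have S1 : S <= S ^ 3 by rewrite expnS leq_pmulr // expn_gt0; lia.
  have -> : size (drop 2 w) = W - 2 by rewrite size_drop.
  lia.
Qed.

End Program.

(** * Running a program in a foreign memory *)

Fixpoint expr_arrays (e : expr) : nat :=
  match e with
  | Cst _ => 0
  | Get a e => maxn a.+1 (expr_arrays e)
  | Succ e | Pred e => expr_arrays e
  | Leq e1 e2 => maxn (expr_arrays e1) (expr_arrays e2)
  end.

Fixpoint cmd_arrays (c : cmd) : nat :=
  match c with
  | Skip => 0
  | Put a e v => maxn a.+1 (maxn (expr_arrays e) (expr_arrays v))
  | Seq c1 c2 => maxn (cmd_arrays c1) (cmd_arrays c2)
  | If e c1 c2 => maxn (expr_arrays e) (maxn (cmd_arrays c1) (cmd_arrays c2))
  | While e c => maxn (expr_arrays e) (cmd_arrays c)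
  | Gate g => \max_(e <- gate_qubits g) expr_arrays e
  | Meas q a e => maxn a.+1 (maxn (expr_arrays q) (expr_arrays e))
  end.

Section Forget.
Variables (R : realType) (A : nat).

Definition forget (m : memory) : memory := fun a i => if a < A then m a i else 0.

Definition forget_config (s : config R) : config R :=
  Config (todo s) (forget (cmem s)) (qst s).

Definition confined (s : config R) : bool :=
  all (fun c => cmd_arrays c <= A) (todo s).

Lemma eval_forget m e : expr_arrays e <= A -> eval (forget m) e = eval m e.
Proof.
elim: e => //= [a e IH|e IH|e IH|e1 IH1 e2 IH2].
- by rewrite geq_max /forget => /andP[-> /IH ->].
- by move=> /IH ->.
- by move=> /IH ->.
- by rewrite geq_max => /andP[/IH1 -> /IH2 ->].
Qed.

Lemma write_forget m a i v : a < A -> write (forget m) a i v = forget (write m a i v).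
Proof.
move=> aA; apply/funext => b; apply/funext => j; rewrite /write /forget /upd.
by case: (eqVneq b a) => [->|_]; rewrite ?aA.
Qed.

Lemma gate_map_forget m g : \max_(e <- gate_qubits g) expr_arrays e <= A ->
  gate_map (eval (forget m)) g = gate_map (eval m) g.
Proof.
case: g => [q|q|q|c t|c d t] /=; rewrite !big_cons big_nil !maxn0 ?geq_max.
1-3: by move=> /eval_forget ->.
  by move=> /andP[/eval_forget -> /eval_forget ->].
by move=> /and3P[/eval_forget -> /eval_forget -> /eval_forget ->].
Qed.

(** A command confined to arrays below [A] neither reads nor writes the others, so a step commutes
    with erasing them. *)
Lemma step_forget s : confined s ->
  step (forget_config s) = map forget_config (step s) /\ all confined (step s).
Proof.
case: s => [[|c k] m psi] //=; rewrite /confined /forget_config /=.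
case/andP=> cA kA; case: c cA => [|a e v|c d|e c d|e c|g|q a e] /=;
  rewrite ?geq_max /=.
- by rewrite kA.
- by case/and3P=> aA eA vA; rewrite !eval_forget // write_forget // kA.
- by case/andP=> -> ->; rewrite kA.
- by case/and3P=> eA cA dA; rewrite eval_forget //; case: ifP; rewrite ?cA ?dA kA.
- case/andP=> eA cA; rewrite eval_forget //; case: ifP => _ /=; last by rewrite kA.
  by rewrite geq_max eA cA kA.
- by move=> gA; rewrite gate_map_forget // kA.
- by case/and3P=> aA qA eA; rewrite !eval_forget // !write_forget // kA.
Qed.

Arguments step : simpl never.

Lemma steps_forget t s : confined s ->
  steps t (forget_config s) = map forget_config (steps t s).
Proof.
move=> cs; suff : steps t (forget_config s) = map forget_config (steps t s) /\
  all confined (steps t s) by case.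
rewrite /steps; elim: t => [|t [IH IHc]] /=; first by rewrite cs.
rewrite IH; elim: (iter _ _ _) IHc {IH} => //= s' ss IH /andP[cs' css].
have [-> cst] := step_forget cs'; have [-> csst] := IH css.
by rewrite map_cat all_cat cst csst.
Qed.

Lemma prob_forget t s (p : pred (config R)) : confined s ->
  p \o forget_config =1 p ->
  prob (steps t (forget_config s)) p = prob (steps t s) p.
Proof.
move=> cs pm; rewrite steps_forget // /prob big_map.
by apply: eq_bigl => s'; exact: pm.
Qed.

End Forget.

Lemma take_mkseq T (f : nat -> T) i n : i <= n -> take i (mkseq f n) = mkseq f i.
Proof. by move=> le; rewrite /mkseq -map_take take_iota (minn_idPl le). Qed.

(** * Success probability of the composed program *)

Section Prob.
Local Open Scope ring_scope.

Lemma sqnorm_ge0 (R : realType) (psi : qvec R nat) : 0 <= sqnorm psi.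
Proof. by rewrite /sqnorm; apply: fsumr_ge0 => b _; exact: sqr_ge0. Qed.

Lemma le_prob (R : realType) (ss : seq (config R)) (p q : pred (config R)) :
  subpred p q -> prob ss p <= prob ss q.
Proof.
move=> pq; rewrite /prob [leLHS]big_mkcond [leRHS]big_mkcond /=.
apply: ler_sum => s _; case: ifPn => [/pq -> //|_].
by case: ifP => // _; exact: sqnorm_ge0.
Qed.

(** Erasing the working arrays left by [prep] yields a genuine initial configuration of [P]; as
    [2 <= A], input array 0 and output array 1 survive. The answer is a prefix of that of [P],
    because the larger circuit is simulated to more digits than are wanted. *)
Lemma computes_after (R : realType) A (prep P : cmd) w w' m' ans ans' B (T T' : R) :
  (2 <= A)%N -> (cmd_arrays P <= A)%N ->
  runs R prep (cmem (init R P w)) m' B ->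
  forget A m' = cmem (init R P w') ->
  (size ans <= size ans')%N -> take (size ans) ans' = ans ->
  computes_within P w' ans' T' -> B.+1%:R + T' <= T ->
  computes_within (Seq prep P) w ans T.
Proof.
move=> A2 PA [s sB ex] m'E szans takeans [t [tT halt out]] BT.
exists (s + t).+1; have -> : steps (s + t).+1 (init R (Seq prep P) w) =
    steps t (Config [:: P] m' (@ket0 R nat)).
  rewrite (@stepsS _ _ _ (Config [:: prep; P] (cmem (init R P w)) (@ket0 R nat))) //.
  by rewrite (stepsD _ (ex _ _)).
have cs : confined A (Config [:: P] m' (@ket0 R nat)) by rewrite /confined /= PA.
have initE : forget_config A (Config [:: P] m' (@ket0 R nat)) = init R P w'.
  by rewrite /forget_config /= m'E.
have outE a : outputs a \o forget_config A =1 @outputs R a.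
  by move=> s'; rewrite /outputs /= /forget A2.
split.
- apply: le_trans BT; rewrite -addSn natrD lerD // ler_nat ltnS //.
- by rewrite -(prob_forget (A := A)) ?initE.
- rewrite -(prob_forget (A := A)) ?initE //; last first.
    by move=> s'; rewrite /= -[outputs ans s' in RHS]outE.
  apply: le_trans out _; apply: le_prob => s' /andP[-> /eqP o] /=.
  by rewrite /outputs -(take_mkseq _ szans) o takeans.
Qed.

End Prob.

(** * The reduction *)

Lemma size_inc n e : 0 < e -> size (inc n e) <= 3 * e.
Proof.
have up j k : size (inc_up n j k) = k by elim: k j => //= k IH j; rewrite IH.
have down k : size (inc_down n k) = k.*2 by elim: k => //= k ->.
case: e => // e _; rewrite /inc size_cat size_rcons up down /=; lia.
Qed.

Lemma size_clause_lits n L ls : 0 < L ->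
  size (clause_lits n L ls) <= size ls * (3 * L + 4).
Proof.
move=> L0; elim: ls => [//|l ls IH].
rewrite -[clause_lits _ _ _]/(lit_gates n L l ++ clause_lits n L ls) size_cat.
rewrite [size (l :: _)]/= mulSn; apply: leq_add => //.
have := size_inc n L0; rewrite /lit_gates /neg_gates /inc !size_cat /=.
by case: (l.2) => /=; lia.
Qed.

Lemma size_nots n j k : size (nots n j k) = k.
Proof. by elim: k j => //= k IH j; rewrite IH. Qed.

Lemma size_count_gates n L phi S : 0 < L -> 0 < S -> n <= S -> L <= S ->
  size phi <= S -> all (fun ls : seq (nat * bool) => size ls <= S) phi ->
  size (count_gates n L phi) <= 25 * S ^ 3.
Proof.
move=> L0 S0 nS LS phiS szs.
have clause ls : size ls <= S -> size (clause_gates n L ls) <= 23 * S ^ 2.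
  have i2 : 0 < L.*2 by rewrite double_gt0.
  move=> lsS; have := size_inc n i2; have := size_clause_lits n ls L0.
  rewrite /clause_gates /inc !size_cat size_nots /=.
  have : size ls * (3 * L + 4) <= S * (3 * S + 4) by apply: leq_mul; lia.
  have : S <= S ^ 2 by rewrite expnS expn1 leq_pmulr.
  by rewrite mulnDr mulnCA -mulnn; lia.
have cnf : size (cnf_gates n L phi) <= size phi * (23 * S ^ 2).
  elim: phi szs {phiS} => [//|ls phi IH] /andP[lsS szs].
  rewrite -[cnf_gates _ _ _]/(clause_gates n L ls ++ cnf_gates n L phi).
  by rewrite size_cat [size (ls :: _)]/= mulSn leq_add ?clause ?IH.
rewrite /count_gates !size_cat /hlayer size_map size_iota.
have : size phi * (23 * S ^ 2) <= 23 * S ^ 3.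
  by rewrite mulnCA (expnS S 2) leq_mul2l /= leq_mul2r phiS orbT.
have : S <= S ^ 3 by rewrite expnS leq_pmulr // expn_gt0 S0.
lia.
Qed.

Lemma encode_gate_map N (o : nat -> 'I_N) g :
  (forall q, q < N -> o q = q :> nat) -> gate_lt N g ->
  encode_gate (gate_map o g) = gate_word g.
Proof.
move=> oK; rewrite /gate_lt; case: g => [q|q|q|c t|c d t] /=; rewrite andbT.
1-3: by move=> /oK ->.
  by case/andP=> /oK -> /oK ->.
by case/and3P=> /oK -> /oK -> /oK ->.
Qed.

Lemma encode_count_circuit N (o : nat -> 'I_N) gs :
  (forall q, q < N -> o q = q :> nat) -> all (gate_lt N) gs ->
  encode_strong (map (gate_map o) gs : circuit N) (nseq_tuple N false) =
  N :: nseq N 0 ++ size gs :: flatten (map gate_word gs).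
Proof.
move=> oK lt; rewrite /encode_strong map_nseq size_map; congr (_ :: _ ++ _ :: flatten _).
elim: gs lt => //= g gs IH /andP[ltg ltgs].
by rewrite encode_gate_map // IH.
Qed.

Lemma count_gates_good N n L phi : 0 < L -> N = n + L.*2.*2 ->
  all (all (fun l : nat * bool => l.1 < n)) phi ->
  all (fun g => gate_wf g && gate_lt N g) (count_gates n L phi).
Proof.
move=> L0 eqN wf; have h : all (fun g => gate_wf g && gate_lt N g) (hlayer n).
  rewrite /hlayer all_map; apply/allP => i; rewrite mem_iota /= => ltin.
  by rewrite /gate_wf /gate_lt /= eqN; lia.
rewrite /count_gates !all_cat h /= andbT.
have := @good_cnf N n L phi L0; rewrite eqN => /(_ (leqnn _) wf).
by rewrite -eqN; apply: sub_all => g /and3P[_ -> ->].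
Qed.

(** * Formulas as lists of literals *)

Section Cnf.
Variables (n : nat) (phi : cnf n).

Definition clause_seq (A : clause n) : seq (nat * bool) :=
  [seq (nat_of_ord l.1, l.2) | l : literal n <- enum A].

Lemma encode_cnfE : encode_cnf phi = cnf_word n (map clause_seq phi).
Proof.
rewrite /encode_cnf /cnf_word size_map -map_comp; congr [:: _, _ & flatten _].
by apply: eq_map => A; rewrite /encode_clause /= -map_comp.
Qed.

Lemma clause_seq_lt : all (all (fun l : nat * bool => l.1 < n)) (map clause_seq phi).
Proof.
rewrite all_map; apply/allP => A _ /=; rewrite all_map; apply/allP => l _ /=.
exact: ltn_ord.
Qed.

Lemma sat_satisfies a : sat_seq (map clause_seq phi) (extend a) = satisfies phi a.
Proof.
rewrite /sat_seq /satisfies all_map; apply: eq_all => A /=; rewrite has_map.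
apply/hasP/existsP => [[l lA e]|[l /andP[lA e]]]; exists l => //.
- by rewrite -mem_enum lA /=; move: e; rewrite /= extendE.
- by rewrite mem_enum.
- by rewrite /= extendE.
Qed.

Lemma size_cnf_word :
  size (cnf_word n (map clause_seq phi)) <= 2 + size phi * (n.*2).+1.
Proof.
rewrite /cnf_word /= !add2n !ltnS.
elim: phi => //= A phi' IH; rewrite size_cat size_rcons size_map mulSn leq_add //.
rewrite ltnS size_map -cardE (leq_trans (max_card _)) //.
by rewrite card_prod card_ord card_bool muln2.
Qed.

Lemma size_clause_seq (W := size (cnf_word n (map clause_seq phi))) :
  size phi <= W /\ all (fun ls => size ls <= W) (map clause_seq phi).
Proof.
split.
  rewrite -(size_map clause_seq) -(count_cnf_word (map clause_seq phi)).
  by rewrite (leq_trans (count_size _ _)) // /W /= ; lia.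
rewrite /W /cnf_word /= {W}; elim: (map clause_seq phi) => //= ls psi IH.
rewrite size_cat size_rcons size_map; apply/andP; split; first lia.
by apply: sub_all IH => ls'; lia.
Qed.

End Cnf.

Local Open Scope ring_scope.

(** A clause has at most 2 n literals, so c n^2 clauses give a word of cubic length. *)
Lemma size_cnf_word_poly n (phi : cnf n) c : (size phi <= c * n ^ 2)%N ->
  (n + (size (cnf_word n (map (@clause_seq n) phi))).*2
   <= (4 + 4 * c) * n.+1 ^ 3)%N.
Proof.
move=> szphi; have := size_cnf_word phi; move: (size _) => W.
have : (size phi * n.*2.+1 <= c * n ^ 2 * n.*2.+1)%N by rewrite leq_mul2r szphi orbT.
move: (size phi * _)%N => x; rewrite !expnS expn0; nia.
Qed.

(** * Binary digits and time bounds *)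

Section Reals.
Variable R : realType.

Lemma truncn_dyadic (k j : nat) : Num.truncn (k%:R / 2 ^+ j : R) = (k %/ 2 ^ j)%N.
Proof.
apply: truncn_def.
have p : 0 < (2 ^+ j : R) by rewrite exprn_gt0.
rewrite -natrX in p *; rewrite ler_pdivlMr // ltr_pdivrMr // -!natrM ler_nat ltr_nat.
by rewrite leq_divM ltn_ceil // expn_gt0.
Qed.

(** For i <= n, truncating 2^i k / 2^n is integer division of k by 2^(n - i). *)
Lemma take_binary_digits (N n k : nat) : (n <= N)%N ->
  take n.+1 (binary_digits N.+1 (k%:R / 2 ^+ n : R)) = binary n k.
Proof.
move=> nN; rewrite take_mkseq ?ltnS // /binary /mkseq; apply/eq_in_map => i.
rewrite mem_iota add0n /= ltnS => iN; congr (_ %% _)%N.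
rewrite -truncn_dyadic; congr Num.truncn.
rewrite mulrCA; congr (_ * _); rewrite -{1}(subnKC iN) exprD invfM mulrA divff ?mul1r //.
Qed.

(** The exponent is split evenly among the factors: [n.+1] is bounded by a constant times 2^(n h)
    through 1 + x <= exp x, and then a power is taken. *)
Lemma poly_le_powR (a e : nat) (eta : R) : 0 < eta ->
  exists K : R, 0 <= K /\ forall n : nat, (a * n.+1 ^ e)%:R <= K * 2 `^ (n%:R * eta).
Proof.
move=> eta0; case: e => [|e].
  exists a%:R; split=> // n; rewrite expn0 muln1 ler_peMr //.
  by rewrite -[leLHS](powRr0 2) ler_powR ?ler1n // mulr_ge0 // ltW.
have ln20 : 0 < ln (2 : R) by rewrite ln_gt0 // ltr1n.
pose h := eta / e.+1%:R; have h0 : 0 < h by rewrite divr_gt0.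
(* Chosen so that k (1 + n h ln 2) >= n + 1. *)
pose k := 1 + (h * ln 2)^-1; have k0 : 0 <= k by rewrite addr_ge0 // invr_ge0 mulr_ge0 // ltW.
exists (a%:R * k ^+ e.+1); split; first by rewrite mulr_ge0 // exprn_ge0.
move=> n; rewrite natrM -mulrA ler_wpM2l //.
have -> : n%:R * eta = n%:R * h * e.+1%:R :> R by rewrite /h -mulrA divfK.
rewrite powRrM powR_mulrn ?powR_ge0 // -exprMn natrX lerXn2r ?nnegrE //.
  by rewrite mulr_ge0 // powR_ge0.
have -> : 2 `^ (n%:R * h) = expR (n%:R * h * ln 2) :> R by rewrite /powR pnatr_eq0.
apply: le_trans (ler_wpM2l k0 (expR_ge1Dx _)).
have hl : 0 < h * ln (2 : R) by rewrite mulr_gt0.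
rewrite /k mulrDl mul1r -natr1 mulrDr mulr1.
have -> : (h * ln 2)^-1 * (n%:R * h * ln 2) = n%:R :> R.
  by rewrite -mulrA mulrCA mulVf ?mulr1 // gt_eqF.
have : 0 <= (h * ln (2 : R))^-1 by rewrite invr_ge0 ltW.
have : 0 <= n%:R * h * ln (2 : R) by rewrite -mulrA mulr_ge0 // ltW.
lra.
Qed.

(** The 4 L extra qubits cost a factor of at most 2^(4 L) <= S^4. Half of the saving [d] pays for
    it, as 2^(n (1 - d)) 2^(n d / 2) = 2^(n (1 - d / 2)). *)
Lemma time_bound (delta d K Kp : R) (a n L S : nat) :
  0 < d -> d <= 1 -> d <= delta -> 0 <= Kp -> (0 < S)%N -> (2 ^ L <= S)%N ->
  (S ^ 4)%:R <= Kp * 2 `^ (n%:R * (d / 2)) ->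
  (a * S ^ 3).+1%:R + K * 2 `^ ((n + L.*2.*2)%:R * (1 - delta)) <=
  (`|K| + a.+1%:R) * Kp * 2 `^ (n%:R * (1 - d / 2)).
Proof.
move=> d0 d1 ddelta Kp0 S0 LS polyS.
set E := 2 `^ (n%:R * (1 - d)); set F := 2 `^ (n%:R * (d / 2)) in polyS *.
set G := 2 `^ (n%:R * (1 - d / 2)).
have GE : G = E * F.
  rewrite /G /E /F -powRD; last by rewrite pnatr_eq0 implybT.
  by congr (_ `^ _); field.
(* By [d <= 1], the bound also absorbs the preparation time, which is not multiplied by [E]. *)
have FG : F <= G.
  by rewrite /F /G ler_powR ?ler1n // ler_wpM2l //; lra.
have E0 : 0 <= E by exact: powR_ge0.
have N_le : 2 `^ ((n + L.*2.*2)%:R * (1 - delta)) <= E * (S ^ 4)%:R.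
  apply: (@le_trans _ _ (E * (2 ^ L.*2.*2)%:R)).
    rewrite natrX -powR_mulrn // /E -powRD; last by rewrite pnatr_eq0 implybT.
    rewrite ler_powR ?ler1n // natrD.
    have : n%:R * (1 - delta) <= n%:R * (1 - d) by rewrite ler_wpM2l // lerD2l lerN2.
    have : L.*2.*2%:R * (1 - delta) <= L.*2.*2%:R :> R.
      by rewrite ler_piMr //; lra.
    lra.
  rewrite ler_wpM2l // ler_nat -!muln2 -mulnA expnM leq_exp2r //.
(* [K] may be negative, hence the absolute value. *)
have K_le : K * 2 `^ ((n + L.*2.*2)%:R * (1 - delta)) <= `|K| * Kp * G.
  apply: (@le_trans _ _ (`|K| * (E * (S ^ 4)%:R))).
    apply: (@le_trans _ _ (`|K| * 2 `^ ((n + L.*2.*2)%:R * (1 - delta)))).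
      by rewrite ler_wpM2r ?powR_ge0 // ler_norm.
    by rewrite ler_wpM2l.
  by rewrite GE -mulrA ler_wpM2l // mulrCA ler_wpM2l.
have S_le : (a * S ^ 3).+1%:R <= a.+1%:R * (Kp * G) :> R.
  apply: (@le_trans _ _ (a.+1%:R * (S ^ 4)%:R)); last first.
    by rewrite ler_wpM2l // (le_trans polyS) // ler_wpM2l.
  rewrite -natrM ler_nat mulSn -add1n leq_add ?expn_gt0 ?S0 //.
  by rewrite leq_mul2l leq_pexp2l ?orbT.
by rewrite addrC !mulrDl lerD // -mulrA.
Qed.

End Reals.

(** Arrays from this index on are free for the preparation; the maximum with 2 protects the input
    and output arrays. *)
Definition reduction (P : cmd) : cmd :=
  Seq (prep_cmd (maxn 2 (cmd_arrays P))) P.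

(** Half of the exponent gain is spent on polynomial overhead, and the minimum with 1 meets the
    needs of [time_bound]. The density [c] affects only constants, so one program serves every
    [c]. *)
Lemma reduction_counts (R : realType) (delta c : R) (P : cmd) : 0 < delta ->
  strongly_simulates (fun n => n.+1) delta P ->
  counts_sat (Num.min delta 1 / 2) c (reduction P).
Proof.
move=> delta0 simP; set d1 := Num.min delta 1.
have d10 : 0 < d1 by rewrite lt_min delta0 ltr01.
have d11 : d1 <= 1 by rewrite ge_min lexx orbT.
have d1d : d1 <= delta by rewrite ge_min lexx.
pose c' := (Num.truncn `|c|).+1.
have cc' : c <= c'%:R by rewrite (le_trans (ler_norm _)) // ltW // truncnS_gt.
pose s0 := (4 + 4 * c')%N.
(* There are at most 25 S^3 gates with S <= s0 (n + 1)^3, whence this coefficient and degree 9. *)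
have [K simK] := simP (25 * s0 ^ 3)%N 9%N.
have d20 : 0 < d1 / 2 by rewrite divr_gt0.
(* Fourth power of the same bound on S, for the factor S^4 in [time_bound]. *)
have [Kp [Kp0 polyK]] := @poly_le_powR R (s0 ^ 4) 12 _ d20.
exists ((`|K| + 3000.+1%:R) * Kp) => n phi szphi.
pose ls := map (@clause_seq n) phi; pose w := cnf_word n ls.
set A := maxn 2 (cmd_arrays P).
have A2 : (1 < A)%N by rewrite leq_max.
have [L [vs [WL LW prepR]]] := @runs_prep R A A2 n ls (clause_seq_lt phi).
rewrite -/w in WL LW prepR.
have [phiW lsW] := size_clause_seq phi; rewrite -/ls -/w in phiW lsW.
set S := (n + (size w).*2)%N in prepR *.
have W2 : (2 <= size w)%N by [].
have L0 : (0 < L)%N by case: (L) WL => //; rewrite ltnNge ltnW.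
have WS : ((size w).*2 <= S)%N by exact: leq_addl.
have LS : (L <= S)%N.
  by rewrite (leq_trans (ltnW (ltn_expl L (ltnSn 1)))) // (leq_trans LW).
have S0 : (0 < S)%N by rewrite (leq_trans _ WS) // double_gt0 ltnW.
have szphi' : (size phi <= c' * n ^ 2)%N.
  rewrite -(ler_nat R) natrM natrX (le_trans szphi) // ler_wpM2r ?exprn_ge0 //.
have Sle : (S <= s0 * n.+1 ^ 3)%N := size_cnf_word_poly szphi'.
pose N := (n + L.*2.*2)%N.
have N0 : (0 < N)%N by rewrite addn_gt0 !double_gt0 L0 orbT.
(* All addresses in the circuit lie below [N], so the default value is never reached. *)
pose o (q : nat) : 'I_N := insubd (Ordinal N0) q.
have oK q : (q < N)%N -> o q = q :> nat by move=> qN; rewrite val_insubd qN.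
pose gs := count_gates n L ls.
pose C : circuit N := map (gate_map o) gs.
have good : all (fun g => gate_wf g && gate_lt N g) gs.
  by apply: count_gates_good => //; exact: clause_seq_lt.
have wfC : all (@gate_wf _) C.
  rewrite all_map; apply: sub_all good => g /andP[wfg ltg] /=.
  exact: gate_wf_map.
have ltgs : all (gate_lt N) gs by apply: sub_all good => g /andP[].
have szC : (size C <= 25 * s0 ^ 3 * N.+1 ^ 9)%N.
  rewrite size_map (leq_trans (size_count_gates (S := S) _ _ _ _ _ _)) //.
  - by rewrite /S leq_addr.
  - by rewrite size_map (leq_trans phiW) // (leq_trans _ WS) // -addnn leq_addr.
  - apply: sub_all lsW => l lW; rewrite (leq_trans lW) // (leq_trans _ WS) //.
    by rewrite -addnn leq_addr.
  rewrite -mulnA leq_mul2l /= (@leq_trans ((s0 * n.+1 ^ 3) ^ 3)) ?leq_exp2r //.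
  by rewrite expnMn -expnM leq_mul2l leq_exp2r // ltnS leq_addr orbT.
have := simK N C (nseq_tuple N false) wfC szC.
have szsL : all (fun l : seq (nat * bool) => (size l < 2 ^ L)%N) ls.
  by apply: sub_all lsW => l lW; exact: leq_ltn_trans lW WL.
have szL : (size ls < 2 ^ L)%N by rewrite size_map (leq_ltn_trans phiW).
rewrite (@amplitude_count R N n o oK L ls L0 erefl (clause_seq_lt phi) szsL szL).
set k := #|_|; have kE : k = count_sat phi.
  by apply: eq_card => a; rewrite !inE sat_satisfies.
rewrite encode_count_circuit // kE => compP.
have nN : (n <= N)%N by exact: leq_addr.
have wE : cmem (init R P (encode_cnf phi)) = ram A [::] [::] w.
  rewrite /= encode_cnfE -/ls -/w; apply/funext => a; apply/funext => i.
  by rewrite /ram !nth_nil; case: (a == 0%N); case: (a == A); case: (a == A.+1).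
rewrite -wE in prepR.
apply: (computes_after A2 (leq_maxr _ _) prepR _ _ _ compP).
- apply/funext => a; apply/funext => i; rewrite /forget /ram /=.
  case: (eqVneq a 0%N) => [->|_]; first by rewrite (ltn_trans _ A2).
  by case: ltnP => // aA; rewrite (ltn_eqF aA) (ltn_eqF (leqW aA)).
- by rewrite !size_mkseq.
- by rewrite size_mkseq take_binary_digits.
apply: time_bound => //; first exact: leq_trans LW WS.
rewrite (le_trans _ (polyK n)) // ler_nat.
have -> : (s0 ^ 4 * n.+1 ^ 12 = (s0 * n.+1 ^ 3) ^ 4)%N by rewrite expnMn -expnM.
by rewrite leq_exp2r.
Qed.

Theorem theorem4p2 (R : realType) :
  sharp_QSETH R ->
  forall delta : R, 0 < delta ->
    ~ exists P : cmd, strongly_simulates (fun n : nat => n.+1) delta P.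
Proof.
move=> hyp delta delta0 [P simP].
have d0 : 0 < Num.min delta 1 / 2 by rewrite divr_gt0 // lt_min delta0 ltr01.
(* Whatever [c] the hypothesis supplies for this exponent, the same reduction contradicts it. *)
have [c _] := hyp _ d0; apply; exists (reduction P).
exact: reduction_counts.
Qed.
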